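(* Let $K$ be a scattered compact Hausdorff space and let $X$ be a subprojective Banach space. Then the Banach space $C(K,X)$ is subprojective.
   Context: Banach spaces are over the real or complex field. A Banach space $X$ is called subprojective if every closed infinite-dimensional subspace of $X$ contains an infinite-dimensional subspace that is complemented in $X$ (a subspace is complemented in $X$ if it is the range of a bounded linear projection on $X$; in particular it is closed). A compact space $K$ is called scattered (or dispersed) if every non-empty closed subset $F$ of $K$ contains a point that is isolated in $F$. $C(K,X)$ denotes the Banach space of continuous functions from $K$ to $X$ with the supremum norm $\|f\|=\sup_{t\in K}\|f(t)\|$. *)

(* Defs.v *)
From HB Require Import structures.
From mathcomp Require Import all_boot all_order all_algebra.
From mathcomp Require Import all_classical all_reals all_analysis.
From mathcomp Require Import complex.

Set Implicit Arguments.
Unset Strict Implicit.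
Unset Printing Implicit Defensive.

Import Order.TTheory GRing.Theory Num.Theory.
Import numFieldNormedType.Exports.

Local Open Scope classical_set_scope.
Local Open Scope ring_scope.

(* A Banach space over the real or complex field is a completeNormedModType
   over [scalar_field R k], which reduces to R or to R[i]. MathComp norms take
   their values in the scalar field, so suprema of norms are computed in R
   through [scalar_re] and [scalar_of_real]. *)
Inductive scalar_kind := RealScalars | ComplexScalars.

Definition scalar_field (R : realType) (k : scalar_kind) : numFieldType :=
  match k with
  | RealScalars => R
  | ComplexScalars => complex R
  end.

Definition scalar_re (R : realType) (k : scalar_kind) : scalar_field R k -> R :=
  match k return scalar_field R k -> R with
  | RealScalars => fun x => x
  | ComplexScalars => fun z => complex.Re z
  end.

Definition scalar_of_real (R : realType) (k : scalar_kind) : R -> scalar_field R k :=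
  match k return R -> scalar_field R k with
  | RealScalars => fun x => x
  | ComplexScalars => fun x => Complex x 0
  end.
Arguments scalar_of_real {R} k _.

Section scalar_theory.
Context {R : realType} {k : scalar_kind}.
Implicit Types (x y : scalar_field R k) (a b : R).

Lemma scalar_reK x : 0 <= x -> scalar_of_real k (scalar_re x) = x.
Proof.
by case: k x => //= -[a b]; rewrite lecE /= => /andP[/eqP <-].
Qed.

Lemma scalar_of_realK a : scalar_re (scalar_of_real k a) = a.
Proof. by case: k. Qed.

Lemma ler_scalar_of_real a b :
  (scalar_of_real k a <= scalar_of_real k b) = (a <= b).
Proof. by case: k => //=; rewrite lecE /= eqxx. Qed.

Lemma scalar_of_real0 : scalar_of_real k (0 : R) = 0.
Proof. by case: k. Qed.

Lemma scalar_of_real_ge0 a : (0 <= scalar_of_real k a) = (0 <= a).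
Proof. by rewrite -scalar_of_real0 ler_scalar_of_real. Qed.

Lemma ler_scalar_re x y : 0 <= x -> 0 <= y ->
  (scalar_re x <= scalar_re y) = (x <= y).
Proof. by move=> x0 y0; rewrite -ler_scalar_of_real !scalar_reK. Qed.

End scalar_theory.

(* C(K, X). The compactness proof is an argument of the carrier only so that
   the sup norm below is a norm on it. *)
Definition cfun (F : numFieldType) (T : topologicalType)
    (cT : compact [set: T]) (X : normedModType F) : Type :=
  continuousType T X.

Section cfun_lmodule.
Context {F : numFieldType} {T : topologicalType} (cT : compact [set: T]).
Context (X : normedModType F).
Notation C := (cfun cT X).
Implicit Types f g h : C.

HB.instance Definition _ := Choice.copy C (continuousType T X).

Lemma cfun_continuous f : continuous f.
Proof. exact: cts_fun. Qed.

Lemma cfunP f g : f =1 g -> f = g.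
Proof. by move=> fg; apply/continuousEP. Qed.

Lemma cfun_zero_cts : continuous (fun _ : T => 0 : X).
Proof. by move=> t; exact: cvg_cst. Qed.

Lemma cfun_opp_cts f : continuous (fun t => - f t).
Proof. by move=> t; apply: cvgN; exact: cfun_continuous. Qed.

Lemma cfun_add_cts f g : continuous (fun t => f t + g t).
Proof. by move=> t; apply: cvgD; exact: cfun_continuous. Qed.

Lemma cfun_scale_cts (a : F) f : continuous (fun t => a *: f t).
Proof. by move=> t; apply: cvgZl_tmp; exact: cfun_continuous. Qed.

Definition cfun_of (f : T -> X) (cf : continuous f) : C :=
  (mkcts cf : continuousType T X).

Definition cfun_zero : C := cfun_of cfun_zero_cts.
Definition cfun_opp f : C := cfun_of (@cfun_opp_cts f).
Definition cfun_add f g : C := cfun_of (@cfun_add_cts f g).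
Definition cfun_scale (a : F) f : C := cfun_of (@cfun_scale_cts a f).

Lemma cfun_addA : associative cfun_add.
Proof. by move=> f g h; apply: cfunP => t; exact: addrA. Qed.

Lemma cfun_addC : commutative cfun_add.
Proof. by move=> f g; apply: cfunP => t; exact: addrC. Qed.

Lemma cfun_add0 : left_id cfun_zero cfun_add.
Proof. by move=> f; apply: cfunP => t; exact: add0r. Qed.

Lemma cfun_addN : left_inverse cfun_zero cfun_opp cfun_add.
Proof. by move=> f; apply: cfunP => t; exact: addNr. Qed.

HB.instance Definition _ :=
  GRing.isZmodule.Build C cfun_addA cfun_addC cfun_add0 cfun_addN.

Lemma cfun_scaleA a b f : cfun_scale a (cfun_scale b f) = cfun_scale (a * b) f.
Proof. by apply: cfunP => t; exact: scalerA. Qed.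

Lemma cfun_scale1 : left_id 1 cfun_scale.
Proof. by move=> f; apply: cfunP => t; exact: scale1r. Qed.

Lemma cfun_scaleDr : right_distributive cfun_scale +%R.
Proof. by move=> a f g; apply: cfunP => t; exact: scalerDr. Qed.

Lemma cfun_scaleDl f : {morph cfun_scale^~ f : a b / a + b}.
Proof. by move=> a b; apply: cfunP => t; exact: scalerDl. Qed.

HB.instance Definition _ := GRing.Zmodule_isLmodule.Build F C
  cfun_scaleA cfun_scale1 cfun_scaleDr cfun_scaleDl.

Lemma cfun0E t : (0 : C) t = 0. Proof. by []. Qed.
Lemma cfunDE f g t : (f + g) t = f t + g t. Proof. by []. Qed.
Lemma cfunNE f t : (- f) t = - f t. Proof. by []. Qed.
Lemma cfunZE a f t : (a *: f) t = a *: f t. Proof. by []. Qed.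

End cfun_lmodule.

Section cfun_norm.
Context {R : realType} {k : scalar_kind} {T : topologicalType}.
Context (cT : compact [set: T]) (X : normedModType (scalar_field R k)).
Notation C := (cfun cT X).
Implicit Types f g : C.

(* The range is empty when T is, and then [sup] is 0. *)
Definition cfun_norm f : scalar_field R k :=
  scalar_of_real k (sup [set scalar_re `|f t| | t in [set: T]]).

Lemma cfun_bounded f : exists M : R, forall t, scalar_re `|f t| <= M.
Proof.
have /(_ R +oo%R (fun M t => scalar_re `|f t| <= M)) cov :=
  (compact_near_coveringP _).1 cT.
have [|M fM] := filter_ex (cov _ _); last by exists M => t; exact: fM.
move=> t _; have /cvgrPdist_lt/(_ 1 ltr01) ft := @cfun_continuous _ _ cT X f t.
exists ([set s | `|f t - f s| < 1], [set M | scalar_re (`|f t| + 1) <= M]).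
  by split => //=; apply: nbhs_pinfty_ge; exact: num_real.
move=> [s M] [/= fts]; apply: le_trans.
rewrite ler_scalar_re ?addr_ge0// -lerBlDl (le_trans (lerB_dist _ _))//.
by rewrite distrC ltW.
Qed.

Lemma cfun_norm_ub f t : `|f t| <= cfun_norm f.
Proof.
rewrite -[leLHS]scalar_reK// ler_scalar_of_real; apply: ub_le_sup.
  by have [M fM] := cfun_bounded f; exists M => _ [s _ <-].
by exists t.
Qed.

Lemma cfun_norm_lub f (M : scalar_field R k) :
  0 <= M -> (forall t, `|f t| <= M) -> cfun_norm f <= M.
Proof.
move=> M0 fM; rewrite -[leRHS]scalar_reK// ler_scalar_of_real.
have [->|/set0P ne] :=
    eqVneq [set scalar_re `|f t| | t in [set: T]] set0.
  by rewrite sup0 -(@scalar_of_real_ge0 _ k) scalar_reK.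
by apply: ge_sup => // _ [t _ <-]; rewrite ler_scalar_re.
Qed.

Lemma cfun_norm_ge0 f : 0 <= cfun_norm f.
Proof.
rewrite scalar_of_real_ge0; have [M fM] := cfun_bounded f.
have [->|/set0P[_ [t _ _]]] :=
    eqVneq [set scalar_re `|f t| | t in [set: T]] set0; first by rewrite sup0.
rewrite -(@scalar_of_real_ge0 _ k); exact: le_trans (cfun_norm_ub f t).
Qed.

Lemma cfun_ler_normD f g : cfun_norm (f + g) <= cfun_norm f + cfun_norm g.
Proof.
apply: cfun_norm_lub => [|t]; first by rewrite addr_ge0 ?cfun_norm_ge0.
by rewrite cfunDE (le_trans (ler_normD _ _))// lerD ?cfun_norm_ub.
Qed.

Lemma cfun_normrZ (a : scalar_field R k) f : cfun_norm (a *: f) = `|a| * cfun_norm f.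
Proof.
have le_normZ (b : scalar_field R k) h : cfun_norm (b *: h) <= `|b| * cfun_norm h.
  apply: cfun_norm_lub => [|t]; first by rewrite mulr_ge0 ?cfun_norm_ge0.
  by rewrite cfunZE normrZ ler_wpM2l ?cfun_norm_ub.
apply/eqP; rewrite eq_le le_normZ /=.
have [->|a0] := eqVneq a 0; first by rewrite normr0 mul0r cfun_norm_ge0.
rewrite -ler_pdivlMl ?normr_gt0// -normfV.
by rewrite -{1}(scale1r f) -(mulVf a0) -scalerA le_normZ.
Qed.

Lemma cfun_normr0_eq0 f : cfun_norm f = 0 -> f = 0.
Proof.
move=> f0; apply: cfunP => t; apply/eqP; rewrite -normr_le0.
by rewrite -f0 cfun_norm_ub.
Qed.

HB.instance Definition _ := Lmodule_isNormed.Build (scalar_field R k) C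
  cfun_ler_normD cfun_normrZ cfun_normr0_eq0.

Lemma cfun_normE f :
  `|f| = scalar_of_real k (sup [set scalar_re `|f t| | t in [set: T]]).
Proof. by []. Qed.

End cfun_norm.

Section cfun_complete.
Context {R : realType} {k : scalar_kind} {T : topologicalType}.
Context (cT : compact [set: T]) (X : completeNormedModType (scalar_field R k)).
Notation C := (cfun cT X).

Lemma cfun_complete (F : set_system C) : ProperFilter F -> cauchy F -> cvg F.
Proof.
move=> FF /cauchy_ballP Fc.
have evc (t : T) : cvg ((fun f : C => f t) @ F).
  apply: cauchy_cvg; apply/cauchy_ballP => e e0; near_simpl.
  have := Fc e e0; apply: filterS => -[f g] /=.
  rewrite -!ball_normE /=; apply: le_lt_trans.
  by rewrite -cfunNE -cfunDE; exact: cfun_norm_ub.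
pose l (t : T) : X := lim ((fun f : C => f t) @ F).
have Fl (t : T) : (fun f : C => f t) @ F --> l t := evc t.
have unif (e : scalar_field R k) : 0 < e ->
    F [set f : C | forall t, `|l t - f t| <= e].
  move=> e0; have := Fc (e / 2); rewrite divr_gt0// => /(_ isT) Fe.
  have : \forall f \near F & g \near F, ball (f : C) (e / 2) (g : C) by [].
  move=> /nearP_dep; apply: filterS => f fF t.
  have /cvgrPdist_lt/(_ (e / 2)) := Fl t; rewrite divr_gt0// => /(_ isT) lF.
  have [g [lg fg]] := filter_ex (filterI lF fF).
  rewrite (splitr e) (le_trans (ler_distD (g t) _ _))// lerD//; first exact: ltW.
  move: fg; rewrite -ball_normE /= distrC => /ltW; apply: le_trans.
  by rewrite -cfunNE -cfunDE; exact: cfun_norm_ub.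
have lc : continuous l.
  move=> t; apply/cvgrPdist_lt => e e0.
  have e3 : 0 < e / 3 by rewrite divr_gt0.
  have [f lf] := filter_ex (unif _ e3).
  have /cvgrPdist_lt/(_ _ e3) := @cfun_continuous _ _ cT X f t.
  apply: filterS => s fts.
  have -> : e = e / 3 + e / 3 + e / 3.
    by rewrite -!mulrDl -mulr2n -mulrSr -(mulr_natr e 3) mulfK// pnatr_eq0.
  rewrite (le_lt_trans (ler_distD (f s) _ _))// ltr_leD//; last first.
    by rewrite distrC.
  by rewrite (le_lt_trans (ler_distD (f t) _ _))// ler_ltD.
apply/cvg_ex; exists (cfun_of cT lc); apply/cvgrPdist_le => e e0.
apply: filterS (unif e e0) => f lf.
by apply: cfun_norm_lub => [|t]; [exact: ltW|exact: lf].
Qed.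

HB.instance Definition _ := Uniform_isComplete.Build C cfun_complete.

End cfun_complete.

Definition scattered (T : topologicalType) :=
  forall F : set T, closed F -> F !=set0 -> isolated F !=set0.

Section subprojective.
Context {K : numFieldType}.

Definition is_subspace (V : lmodType K) (M : set V) :=
  GRing.submod_closed (fun x : V => x \in M).

Definition infinite_dimensional (V : lmodType K) (M : set V) :=
  ~ exists (n : nat) (e : 'I_n -> V), (forall i, M (e i)) /\
      forall x, M x -> exists c : 'I_n -> K, x = \sum_(i < n) c i *: e i.

Definition complemented (V : normedModType K) (N : set V) :=
  exists P : {linear V -> V},
    [/\ exists c : K, forall x, `|P x| <= c * `|x|,
        forall x, P (P x) = P x
      & range P = N].

Definition subprojective (V : completeNormedModType K) :=
  forall M : set V, is_subspace M -> closed M -> infinite_dimensional M ->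
  exists N : set V, [/\ is_subspace N, N `<=` M,
    infinite_dimensional N & complemented N].

End subprojective.

(* Main.v *)
(* For a closed subspace M of C(K, X) and a set F of points of K,
   either sup over F is equivalent to the norm on some infinite-dimensional
   subspace of M, or restriction to F is strictly singular on M. Call F
   "subprojective" if every M normed by F contains an infinite-dimensional
   complemented subspace. Points are such because X is subprojective and
   evaluation at a point is then an isomorphism of M onto a closed subspace of X;
   finite unions are because a sum of strictly singular operators is strictly
   singular; hence compact sets that are locally such are.
   If K were not, the closed set of points without a subprojective neighbourhood
   would have an isolated point t, with a closed neighbourhood F all of whose
   closed subsets missing t are subprojective. Take M normed by F such that
   restriction to t and to all those subsets is strictly singular on M. A gliding
   hump converging to t yields unit vectors f_n in M, almost disjointly supported
   on F, hence equivalent to the c_0 basis, with peaks at points u_n. As K is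
   scattered, a subsequence of u_n converges to some s, and with functionals
   psi_n normalised at f_n(u_n), the functionals g |-> psi_n(g(u_n) - g(s)) are
   weakly null and almost biorthogonal to (f_n), which complements the span. *)

Require Import Defs.
From HB Require Import structures.
From mathcomp Require Import all_boot all_order all_algebra.
From mathcomp Require Import all_classical all_reals all_analysis.
From mathcomp Require Import complex ring lra.
Set Implicit Arguments.
Unset Strict Implicit.
Unset Printing Implicit Defensive.
Import Order.TTheory GRing.Theory Num.Theory.
Import numFieldNormedType.Exports.
Local Open Scope classical_set_scope.
Local Open Scope ring_scope.

(** * The Hahn-Banach theorem over the real and complex numbers *)

Section hahn_banach_real.
Context {R : realType} {V : lmodType R} (p : V -> R).
Hypothesis pD : forall x y, p (x + y) <= p x + p y.
Hypothesis pZ : forall a x, p (a *: x) = `|a| * p x.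

(* Partial functionals are handled through their graphs: a linear subspace of
   V * R lying below p is automatically the graph of a functional. *)
Let dominated (G : set (V * R^o)) :=
  (forall (a : R) g h, G g -> G h -> G (a *: g + h)) /\
  (forall g, G g -> g.2 <= p g.1).

(** An admissible [c] must lie between all numbers h.2 - p (h.1 - x0) and all p (h.1 + x0) - h.2.
    Subadditivity puts the first family below the second, so its supremum works; scaling by 1/|a|
    reduces a nonzero [a] to 1 or -1. *)
Lemma dominated_extend (G : set (V * R^o)) (x0 : V) :
    dominated G -> G 0 ->
  exists c : R^o, dominated [set g | exists a h, G h /\ g = a *: (x0, c) + h].
Proof.
move=> [linG domG] G0.
pose S := [set r : R | exists2 h, G h & r = h.2 - p (h.1 - x0)].
have GZ a h : G h -> G (a *: h) by move=> Gh; rewrite -[_ *: _]addr0; exact: linG.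
have Sub h : G h -> ubound S (p (h.1 + x0) - h.2).
  move=> Gh _ [g Gg ->]; rewrite lerBrDr addrAC lerBlDr.
  have /domG/= := linG 1 _ _ Gg Gh; rewrite scale1r => /le_trans; apply.
  rewrite [leRHS]addrC (le_trans _ (pD _ _))//.
  by rewrite scale1r addrACA addNr addr0.
have S0 : S !=set0 by exists (- p (- x0)); exists 0 => //=; rewrite !sub0r.
pose c := sup S; exists c; split.
  move=> a _ _ [b [g [Gg ->]]] [d [h [Gh ->]]].
  exists (a * b + d), (a *: g + h); split; first exact: linG.
  by rewrite scalerDl scalerDr addrACA scalerA.
move=> _ [a [h [Gh ->]]] /=.
have [a0|a0|->] := ltgtP a 0; last 1 first.
- by rewrite !scale0r !add0r; exact: domG.
- have : (- a)^-1 * h.2 - p ((- a)^-1 *: h.1 - x0) <= c.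
    apply: ub_le_sup; first by exists (p (0 + x0) - 0); exact: (Sub 0).
    by exists ((- a)^-1 *: h) => //; exact: GZ.
  rewrite lerBlDr -(@ler_pM2l _ (- a)) ?oppr_gt0// mulrA divff ?oppr_eq0
    ?lt_eqF//.
  rewrite mul1r mulrDr -{2}[- a]gtr0_norm ?oppr_gt0// -pZ scalerBr scalerA.
  rewrite divff ?oppr_eq0 ?lt_eqF// scale1r scaleNr opprK mulNr.
  by rewrite [a *: x0 + _]addrC => ?; rewrite -[_ *: c]/(a * c); lra.
- have : c <= p (a^-1 *: h.1 + x0) - a^-1 * h.2.
    by apply: ge_sup => //; apply: (Sub (a^-1 *: h)); exact: GZ.
  rewrite lerBrDr -(@ler_pM2l _ a)// mulrDr mulrA divff ?gt_eqF// mul1r.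
  rewrite -[X in _ <= X * _]gtr0_norm// -pZ scalerDr scalerA divff ?gt_eqF//
    scale1r.
  by rewrite [a *: x0 + _]addrC => ?; rewrite -[_ *: c]/(a * c); lra.
Qed.

Lemma hahn_banach_real (v : V) : exists u : V -> R,
  [/\ forall a x y, u (a *: x + y) = a * u x + u y,
      forall x, u x <= p x & u v = p v].
Proof.
have p0 : p 0 = 0 by rewrite -(scale0r 0) pZ normr0 mul0r.
have p_ge0 x : 0 <= p x.
  have := pD x (- x); rewrite subrr p0 -scaleN1r pZ normrN1 mul1r -mulr2n.
  by rewrite pmulrn_lge0.
pose line : set (V * R^o) := [set (a *: v, a * p v : R^o) | a in setT].
pose P (G : set (V * R^o)) := G = set0 \/ line `<=` G /\ dominated G.
have [F FP Ftot|G [PG Gmax]] := @Zorn_bigcup _ P.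
  have [[G [FG G0]]|F0] := pselect (exists G, F G /\ G !=set0); last first.
    left; rewrite -subset0 => x [G FG Gx]; apply: F0.
    by exists G; split => //; exists x.
  have PF H g : F H -> H g -> line `<=` H /\ dominated H.
    by move=> FH Hg; have [H0|//] := FP _ FH; rewrite H0 in Hg.
  right; split; last split.
  - by have [x Gx] := G0; have [lG _] := PF _ _ FG Gx; move=> y /lG Gy; exists G.
  - move=> a g h [H FH Hg] [H' FH' Hh].
    have [HH|HH] := Ftot _ _ FH FH'.
      exists H' => //; have [_ [lin _]] := PF _ _ FH' Hh.
      by apply: lin => //; exact: HH.
    exists H => //; have [_ [lin _]] := PF _ _ FH Hg.
    by apply: lin => //; exact: HH.
  - by move=> g [H FH Hg]; have [_ [_]] := PF _ _ FH Hg; apply.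
have domline : dominated line.
  split=> [a _ _ [b _ <-] [d _ <-]|_ [a _ <-]/=].
    exists (a * b + d) => //; congr pair; first by rewrite scalerDl -scalerA.
    by rewrite mulrDl -mulrA.
  by rewrite pZ ler_wpM2r// ler_norm.
have line0 : line (v, p v) by exists 1 => //; rewrite scale1r mul1r.
have [lG [linG domG]] : line `<=` G /\ dominated G.
  case: PG => // G0; exfalso; apply: (Gmax line); last by right; split.
  by rewrite G0; split=> [x []|/(_ _ line0)].
have G0 : G 0 by apply: lG; exists 0 => //; rewrite scale0r mul0r.
have total x : exists r, G (x, r).
  have [c dc] := dominated_extend x (conj linG domG) G0.
  exists c; apply: contrapT => Gc; apply: (Gmax _ _ (or_intror (conj _ dc))).
    split; last first.
      move=> /(_ (x, c)) sub; apply: Gc; apply: sub; exists 1, 0; split => //.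
      by rewrite scale1r addr0.
    by move=> g Gg; exists 0, g; rewrite scale0r add0r.
  by move=> g /lG Gg; exists 0, g; rewrite scale0r add0r.
(* The difference of two values at [x] lies over the point 0, where [p] vanishes. *)
have uniqG x r s : G (x, r) -> G (x, s) -> r = s.
  have le r' s' : G (x, r') -> G (x, s') -> r' <= s'.
    move=> Gr Gs; have : -1 * s' + r' <= p (-1 *: x + x).
      exact: domG (linG (-1) _ _ Gs Gr).
    by rewrite scaleN1r addNr p0 mulN1r addrC subr_le0.
  by move=> Gr Gs; apply/eqP; rewrite eq_le !le.
have [u Gu] := choice total; exists u; split=> [a x y|x|].
- by apply: uniqG (Gu _) _; exact: linG a _ _ (Gu x) (Gu y).
- exact: domG (Gu x).
- by apply: uniqG (Gu _) _; exact: lG.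
Qed.

End hahn_banach_real.

(** * Passage from real to complex functionals *)

Section scalar_morphism.
Context {R : realType} {k : scalar_kind}.
Implicit Types (x y : scalar_field R k) (a b : R).

Lemma scalar_of_realD a b :
  scalar_of_real k (a + b) = scalar_of_real k a + scalar_of_real k b.
Proof. by case: k => //=; rewrite /GRing.add /= addr0. Qed.

Lemma scalar_of_realM a b :
  scalar_of_real k (a * b) = scalar_of_real k a * scalar_of_real k b.
Proof.
by case: k => //=; rewrite /GRing.mul /= mulr0 mul0r mulr0 subr0 addr0.
Qed.

Lemma scalar_of_real1 : scalar_of_real k (1 : R) = 1.
Proof. by case: k. Qed.

Lemma norm_scalar_of_real a : `|scalar_of_real k a| = scalar_of_real k `|a|.
Proof.
case: k => //=.
by have [a0|a0] := leP 0 a;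
  [rewrite ger0_norm ?lecR// ger0_norm|rewrite ltr0_norm ?ltcR// ltr0_norm//];
  rewrite // /GRing.opp /= oppr0.
Qed.

Lemma scalar_reD x y : scalar_re (x + y) = scalar_re x + scalar_re y.
Proof. by case: k x y => //= -[a b] [c d]. Qed.

Lemma scalar_re_ofM a x : scalar_re (scalar_of_real k a * x) = a * scalar_re x.
Proof. by case: k x => //= -[b c] /=; rewrite mul0r subr0. Qed.

Lemma scalar_re_le_norm x : scalar_re x <= scalar_re `|x|.
Proof.
case: k x => /= x; first exact: ler_norm.
rewrite (le_trans (ler_norm _))//; case: x => a b /=.
rewrite -sqrtr_sqr ler_wsqrtr//.
by rewrite lerDl sqr_ge0.
Qed.

End scalar_morphism.

(** Restriction of scalars to [R]; the alias keeps the real module structure apart from the original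
    one. *)
Definition realified (R : realType) (k : scalar_kind)
  (V : lmodType (scalar_field R k)) : Type := V.

Section realified.
Context {R : realType} {k : scalar_kind} (V : lmodType (scalar_field R k)).

HB.instance Definition _ := GRing.Zmodule.on (realified V).

Definition realified_scale (a : R) (x : realified V) : realified V :=
  scalar_of_real k a *: (x : V).

Lemma realified_scaleA a b x :
  realified_scale a (realified_scale b x) = realified_scale (a * b) x.
Proof. by rewrite /realified_scale scalerA -scalar_of_realM. Qed.

Lemma realified_scale1 : left_id 1 realified_scale.
Proof. by move=> x; rewrite /realified_scale scalar_of_real1 scale1r. Qed.

Lemma realified_scaleDr : right_distributive realified_scale +%R.
Proof. by move=> a x y; exact: scalerDr. Qed.

Lemma realified_scaleDl x : {morph realified_scale^~ x : a b / a + b}.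
Proof. by move=> a b; rewrite /realified_scale scalar_of_realD scalerDl. Qed.

HB.instance Definition _ := GRing.Zmodule_isLmodule.Build R (realified V)
  realified_scaleA realified_scale1 realified_scaleDr realified_scaleDl.

End realified.

(* A real-linear functional u is the real part of the complex-linear
   x |-> u x - i u (i x). *)
Lemma complexify_functional (R : realType) (k : scalar_kind)
    (V : lmodType (scalar_field R k)) (u : V -> R) :
    (forall (a : R) x y, u (scalar_of_real k a *: x + y) = a * u x + u y) ->
  exists phi : V -> scalar_field R k,
    (forall a x y, phi (a *: x + y) = a * phi x + phi y) /\
    forall x, scalar_re (phi x) = u x.
Proof.
case: k V u => /= V u uP; first by exists u.
have u0 : u 0 = 0.
  by have := uP 1 0 0; rewrite -[Complex 1 0]/(1 : R[i]) scaler0 addr0; lra.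
have uD x y : u (x + y) = u x + u y.
  by have := uP 1 x y; rewrite -[Complex 1 0]/(1 : R[i]) scale1r mul1r.
have uZ (a : R) x : u (a%:C%C *: x) = a * u x.
  by have := uP a x 0; rewrite !addr0 u0 addr0.
have uiZ b x : u (('i%C * b%:C%C) *: x) = b * u ('i%C *: x).
  by rewrite mulrC -scalerA uZ.
have uiiZ b x : u ('i%C *: (('i%C * b%:C%C) *: x)) = - b * u x.
  by rewrite scalerA mulrA -expr2 sqr_i mulN1r -rmorphN uZ.
have uiC b x : u ('i%C *: (b%:C%C *: x)) = b * u ('i%C *: x).
  by rewrite scalerA uiZ.
exists (fun x => Complex (u x) (- u ('i%C *: x))); split=> // a x y.
rewrite (complexE a); case: a => a b /=.
rewrite !scalerDl !scalerDr !uD uZ uiZ uiiZ uiC.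
by apply/eqP; rewrite eq_complex /=; apply/andP; split; apply/eqP; ring.
Qed.

Lemma hahn_banach (R : realType) (k : scalar_kind)
    (V : normedModType (scalar_field R k)) (v : V) : v != 0 ->
  exists phi : {scalar V}, phi v = 1 /\ forall x, `|phi x| <= `|x| / `|v|.
Proof.
move=> v0; pose p (x : realified V) : R := scalar_re `|x : V|.
have pD x y : p (x + y) <= p x + p y.
  by rewrite -scalar_reD ler_scalar_re ?addr_ge0// ler_normD.
have pZ a x : p (a *: x) = `|a| * p x.
  by rewrite /p normrZ norm_scalar_of_real scalar_re_ofM.
have [u [ulin up uv]] := hahn_banach_real pD pZ v.
have [phi [philin phiu]] := complexify_functional ulin.
have phi_le x : `|phi x| <= `|x|.
  rewrite -ler_scalar_re//.
  have [->|x0] := eqVneq (phi x) 0; first by rewrite normr0 ler_scalar_re.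
  have phi0 : phi 0 = 0.
    by apply: (addrI (phi 0));
      rewrite addr0 -{1}[phi 0]mul1r -philin scaler0 addr0.
  have phiZ a y : phi (a *: y) = a * phi y.
    by have := philin a y 0; rewrite !addr0 phi0 addr0.
  (* Rotating [x] by a scalar of modulus one makes the value of [phi] real and nonnegative and keeps
     the norm, so the bound on the real part [u] passes to |phi x|. *)
  have /(congr1 (@scalar_re R k)) : `|phi x| = phi ((`|phi x| / phi x) *: x).
    by rewrite phiZ divfK.
  rewrite phiu => ->; apply: (le_trans (up _)); rewrite /p normrZ.
  by rewrite normf_div normr_id divff ?normr_eq0// mul1r.
have phiv : `|v| <= `|phi v|.
  by rewrite -ler_scalar_re// -[leLHS]uv -phiu scalar_re_le_norm.
have phiv0 : phi v != 0.
  by rewrite -normr_gt0 (lt_le_trans _ phiv)// normr_gt0.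
pose psi x := phi x / phi v.
have psilin : scalar psi.
  by move=> a x y; rewrite /psi philin mulrDl mulrA.
pose psiL := GRing.isLinear.Build _ _ _ _ psi psilin.
pose PSI : {scalar V} := HB.pack psi psiL.
exists PSI; split=> [|x]; rewrite /= /psi; first by rewrite divff.
rewrite normf_div ler_pM ?invr_ge0// lef_pV2 ?posrE ?normr_gt0//.
Qed.

(** * Infinite-dimensional subspaces *)

Section infinite_dimensional.
Context {K : numFieldType} {V : lmodType K}.
Implicit Types (M N : set V).

Lemma is_subspaceP M : is_subspace M <->
  M 0 /\ forall a x y, M x -> M y -> M (a *: x + y).
Proof.
split=> -[M0 MD]; split; move: M0; rewrite /= ?unfold_in/= ?inE// => M0.
  by move=> a x y Mx My; have := MD a x y; rewrite !unfold_in/= !inE; exact.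
by move=> a x y; rewrite !unfold_in/= !inE; exact: MD.
Qed.

Lemma subspaceZ M a v : is_subspace M -> M v -> M (a *: v).
Proof. by move=> /is_subspaceP[M0 MD] Mv; rewrite -[_ *: _]addr0; exact: MD. Qed.

Lemma subspaceD M v w : is_subspace M -> M v -> M w -> M (v + w).
Proof. by move=> /is_subspaceP[M0 MD] Mv Mw; rewrite -[v]scale1r; exact: MD. Qed.

Lemma subspaceB M v w : is_subspace M -> M v -> M w -> M (v - w).
Proof.
by move=> sM Mv Mw; rewrite -scaleN1r; apply: subspaceD => //; exact: subspaceZ.
Qed.

Lemma subspace_sum M (I : Type) (r : seq I) (P : pred I) (F : I -> V) :
  is_subspace M -> (forall i, P i -> M (F i)) -> M (\sum_(i <- r | P i) F i).
Proof.
move=> sM MF; elim/big_ind : _ => //; first by have [] := (is_subspaceP M).1 sM.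
by move=> v w; exact: subspaceD.
Qed.

Definition independent (x : nat -> V) n := forall a : nat -> K,
  \sum_(i < n) a i *: x i = 0 -> forall i, (i < n)%N -> a i = 0.

(** If n vectors generated [M], the coordinates of n + 1 independent vectors would form a matrix
    with a nonzero left kernel, that is, a nontrivial relation. *)
Lemma independent_infinite_dimensional M :
    (forall n, exists x, (forall i, M (x i)) /\ independent x n) ->
  infinite_dimensional M.
Proof.
move=> Mfree [n [e [Me eM]]]; have [x [Mx fx]] := Mfree n.+1.
have [c cE] := choice (fun i => eM _ (Mx i)).
pose C := \matrix_(i < n.+1, j < n) c i j.
have : kermx C != 0.
  by rewrite kermx_eq0 /row_free neq_ltn (leq_ltn_trans (rank_leq_col C)).
move=> /rowV0Pn[v /sub_kermxP vC /negP]; apply; apply/eqP/rowP => i.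
rewrite mxE -(inord_val i); apply: (fx (fun i => v 0 (inord i))) => //.
under eq_bigr => j _ do rewrite inord_val cE scaler_sumr.
rewrite exchange_big big1//= => j _.
have vCj : \sum_(l < n.+1) v 0 l * c l j = 0.
  transitivity ((v *m C) 0 j); last by rewrite vC mxE.
  by rewrite mxE; apply: eq_bigr => l _; rewrite mxE.
under eq_bigr => l _ do rewrite scalerA.
by rewrite -scaler_suml vCj scale0r.
Qed.

Lemma infinite_dimensional_independent M n : is_subspace M ->
  infinite_dimensional M -> exists x, (forall i, M (x i)) /\ independent x n.
Proof.
move=> sM infM; elim: n => [|n [x [Mx fx]]].
  by exists (fun=> 0); split=> //; have [] := (is_subspaceP M).1 sM.
have [y [My yspan]] : exists y, M y /\
    ~ exists c : 'I_n -> K, y = \sum_(i < n) c i *: x i.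
  apply: contrapT => allspan; apply: infM; exists n, (fun i => x i);
    split=> // y My.
  by apply: contrapT => yspan; apply: allspan; exists y.
exists (fun i => if i == n then y else x i); split=> [i|a]; first by case: ifP.
rewrite big_ord_recr/= eqxx.
under eq_bigr => i _ do rewrite (ltn_eqF (ltn_ord i)).
have [an0|an0] := eqVneq (a n) 0.
  rewrite an0 scale0r addr0 => /fx {}fx i; rewrite ltnS leq_eqVlt.
  by move=> /orP[/eqP->//|]; exact: fx.
move=> /eqP; rewrite addrC addr_eq0 => /eqP ay; exfalso; apply: yspan.
exists (fun i => - (a n)^-1 * a i).
under eq_bigr do rewrite -scalerA.
by rewrite -scaler_sumr scaleNr -scalerN -ay scalerA mulVf// scale1r.
Qed.

Lemma infinite_dimensionalS M N : is_subspace N -> N `<=` M ->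
  infinite_dimensional N -> infinite_dimensional M.
Proof.
move=> sN NM infN; apply: independent_infinite_dimensional => n.
have [x [Nx fx]] := infinite_dimensional_independent n sN infN.
by exists x; split=> // i; exact: NM.
Qed.

Lemma infinite_dimensional_neq0 M : is_subspace M -> infinite_dimensional M ->
  exists2 v, M v & v != 0.
Proof.
move=> sM infM; have [x [Mx /(_ (fun=> 1)) fx]] :=
  infinite_dimensional_independent 1 sM infM.
exists (x 0); first exact: Mx.
apply/eqP => x0; have /eqP : (1 : K) = 0.
  by apply: fx (isT : (0 < 1)%N); rewrite big_ord1 x0 scaler0.
by rewrite oner_eq0.
Qed.

Lemma subspace_kernels M (phi : nat -> {scalar V}) n : is_subspace M ->
  is_subspace (M `&` [set v | forall i, (i < n)%N -> phi i v = 0]).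
Proof.
move=> /is_subspaceP[M0 MD]; apply/is_subspaceP; split.
  by split=> // i _; rewrite linear0.
move=> a v w [Mv v0] [Mw w0]; split; first exact: MD.
by move=> i il; rewrite linearP v0// w0// addr0; exact: mulr0.
Qed.

(** One vector v of [M] with phi v nonzero, added to generators of the kernel, generates [M],
    because w - (phi w / phi v) v lies in the kernel. *)
Lemma infinite_dimensional_kernel M (phi : {scalar V}) : is_subspace M ->
  infinite_dimensional M -> infinite_dimensional (M `&` [set v | phi v = 0]).
Proof.
move=> sM infM [n [e [Me eM]]].
have [[v Mv v0]|allker] := pselect (exists2 v, M v & phi v != 0); last first.
  apply: infM; exists n, e; split=> [i|v Mv]; first by have [] := Me i.
  apply: eM; split=> //; apply/eqP; apply: contrapT => /negP v0.
  by apply: allker; exists v.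
apply: infM; exists n.+1, (fun i => oapp e v (unlift ord0 i)); split.
  by move=> i; case: unliftP => [j _|_] //=; have [] := Me j.
move=> w Mw; have [|c wE] := eM (w - (phi w / phi v) *: v).
  split; first by apply: subspaceB => //; exact: subspaceZ.
  by rewrite /= linearB linearZ/= divfK// subrr.
exists (fun i => oapp c (phi w / phi v) (unlift ord0 i)).
rewrite big_ord_recl unlift_none/=.
under eq_bigr do rewrite liftK /=.
by rewrite -wE addrC subrK.
Qed.

Lemma infinite_dimensional_kernels M (phi : nat -> {scalar V}) n :
    is_subspace M -> infinite_dimensional M ->
  infinite_dimensional (M `&` [set v | forall i, (i < n)%N -> phi i v = 0]).
Proof.
move=> sM infM; elim: n => [|n IH].
  by apply: infinite_dimensionalS infM => // v Mv.
have := @infinite_dimensional_kernel _ (phi n) (subspace_kernels phi n sM) IH.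
apply: infinite_dimensionalS; last first.
  move=> v [[Mv v0] vn]; split=> // i; rewrite ltnS leq_eqVlt => /predU1P[->//|].
  exact: v0.
have /is_subspaceP[M0 MD] := subspace_kernels phi n sM.
apply/is_subspaceP; split; first by split=> //=; rewrite linear0.
move=> a v w [Mv v0] [Mw w0]; split; first exact: MD.
by rewrite /= linearP v0 w0 addr0; exact: mulr0.
Qed.

End infinite_dimensional.

(** * Complemented subspaces *)

Section normed_closure.
Context {K : numFieldType} {V : normedModType K}.
Implicit Types (A M : set V).

Lemma closure_normP A x :
  closure A x <-> forall e : K, 0 < e -> exists2 y, A y & `|x - y| < e.
Proof.
split=> [Ax e e0|Ax B /nbhs_ballP[e /= e0 eB]].
  have [y [Ay]] := Ax _ (nbhsx_ballx x e e0).
  by rewrite -ball_normE; exists y.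
have [y Ay xy] := Ax e e0; exists y; split=> //.
by apply: eB; rewrite -ball_normE.
Qed.

Lemma norm_lt_le (x : V) (b : K) : 0 <= b ->
  (forall e : K, 0 < e -> `|x| <= b + e) -> `|x| <= b.
Proof.
move=> b0 xb; rewrite real_leNgt ?normr_real ?ger0_real//.
apply/negP => bx; have d0 : 0 < `|x| - b by rewrite subr_gt0.
have := xb ((`|x| - b) / 2); rewrite divr_gt0// => /(_ isT).
rewrite -lerBlDl lt_geF// ltr_pdivrMr// ltr_pMr// ltr1n//.
Qed.

Lemma closure_subspace M : is_subspace M -> is_subspace (closure M).
Proof.
move=> sM; have [M0 MD] := (is_subspaceP M).1 sM; apply/is_subspaceP; split.
  exact: subset_closure.
move=> a x y /closure_normP Mx /closure_normP My; apply/closure_normP => e e0.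
have a0 : 0 < `|a| + 1 by rewrite ltr_wpDl.
have [x' Mx' xx'] :=
  Mx (e / 2 / (`|a| + 1)) (divr_gt0 (divr_gt0 e0 (ltr0Sn K 1)) a0).
have [y' My' yy'] := My (e / 2) (divr_gt0 e0 (ltr0Sn K 1)).
exists (a *: x' + y'); first exact: MD.
rewrite opprD addrACA -scalerBr (le_lt_trans (ler_normD _ _))//.
rewrite [e]splitr ler_ltD// normrZ (@le_trans _ _ ((`|a| + 1) * `|x - x'|))//.
  by rewrite ler_wpM2r// lerDl.
by rewrite mulrC -ler_pdivlMr// ltW.
Qed.

Lemma closure_sub_closed A M : closed M -> A `<=` M -> closure A `<=` M.
Proof. by move=> cM AM x /(closureS AM)/cM. Qed.

End normed_closure.

(** For y in the closure of the image, the points of [M] with image near y generate a filter, which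
    is Cauchy by the lower bound; its limit lies in [M] and is sent to y by continuity. *)
Lemma closed_image_bounded_below (K : numFieldType) (V : completeNormedModType K)
    (W : normedModType K) (f : {linear V -> W}) (M : set V) (b c : K) :
    is_subspace M -> closed M -> 0 <= b -> 0 < c ->
      (forall x, `|f x| <= b * `|x|) ->
  (forall x, M x -> c * `|x| <= `|f x|) -> closed (f @` M).
Proof.
move=> sM cM b_ge0 c0 fb fc y /closure_normP yM.
pose F := filter_from [set e : K | 0 < e]
  (fun e => [set x | M x /\ `|y - f x| < e]).
have FF : ProperFilter F.
  apply: filter_from_proper => [|e /yM[_ [x Mx <-] xe]]; last by exists x.
  apply: filter_from_filter; first by exists 1; exact: ltr01.
  move=> d e /= d0 e0; have [de|ed] := real_leP (gtr0_real d0) (gtr0_real e0).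
    by exists d => // x [Mx xd]; split; split=> //; exact: lt_le_trans de.
  by exists e => // x [Mx xe]; split; split=> //; exact: lt_trans ed.
have Fc : cauchy F.
  apply/cauchy_ballP => e e0;
    have ce0 : 0 < c * e / 2 by rewrite divr_gt0// mulr_gt0.
  exists ([set x | M x /\ `|y - f x| < c * e / 2],
          [set x | M x /\ `|y - f x| < c * e / 2]).
    by split; exists (c * e / 2).
  move=> [u v] [[Mu yu] [Mv yv]] /=; rewrite -ball_normE /=.
  rewrite -(ltr_pM2l c0) (le_lt_trans (fc _ (subspaceB sM Mu Mv)))//.
  rewrite linearB -[f u](subrK y) -addrA (le_lt_trans (ler_normD _ _))//.
  by rewrite [c * e]splitr ltrD// distrC.
have [x Fx] : exists x : V, F --> x by apply/cvg_ex; exact: cauchy_cvg.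
have FM : F M by exists 1; [exact: ltr01|move=> z []].
have Mx : M x by exact: (@closed_cvg _ _ F _ id M cM FM x Fx).
exists x => //; apply/eqP; rewrite -subr_eq0 -normr_le0 norm_lt_le// => e e0.
have b0 : 0 < b + 1 by rewrite ltr_wpDl.
have Fe : F [set z | M z /\ `|y - f z| < e / 2].
  by exists (e / 2) => //; rewrite /= divr_gt0.
have Fxe : F [set z | `|x - z| < e / 2 / (b + 1)].
  by apply: ((@cvgrPdist_lt _ _ _ F _ id x).1 Fx); rewrite !divr_gt0.
have [z [[Mz yz] xz]] := filter_ex (filterI Fe Fxe).
rewrite add0r -[f x](subrK (f z)) -addrA (le_trans (ler_normD _ _))//.
rewrite [e]splitr lerD//; last by rewrite distrC ltW.
rewrite -linearB (le_trans (fb _))//.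
rewrite (@le_trans _ _ ((b + 1) * `|x - z|))//; last first.
  by rewrite mulrC -ler_pdivlMr// ltW.
by rewrite ler_wpM2r// lerDl.
Qed.

Section scalar_sequences.
Context {R : realType} {k : scalar_kind}.
Local Notation K := (scalar_field R k).

Lemma scalar_of_real_natr n : scalar_of_real k (n%:R : R) = n%:R.
Proof.
elim: n => [|n IH]; first exact: scalar_of_real0.
by rewrite -!natr1 scalar_of_realD IH scalar_of_real1.
Qed.

Lemma half_exprn_small (a e : K) : 0 <= a -> 0 < e ->
  exists n, a * 2^-1 ^+ n < e.
Proof.
move=> a0 e0; exists (Num.bound (scalar_re (a / e))).
have : a / e < (Num.bound (scalar_re (a / e)))%:R.
  have ae0 : 0 <= a / e by rewrite divr_ge0// ltW.
  rewrite -[X in X < _]scalar_reK// -scalar_of_real_natr lt_neqAle.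
  rewrite ler_scalar_of_real ltW ?archi_boundP// ?andbT.
    apply/eqP => /(congr1 (@scalar_re R k)); rewrite !scalar_of_realK => /eqP.
    apply/negP; rewrite lt_eqF// archi_boundP//.
    by rewrite -(@scalar_of_real_ge0 _ k) scalar_reK.
  by rewrite -(@scalar_of_real_ge0 _ k) scalar_reK.
rewrite ltr_pdivrMr// exprVn ltr_pdivrMr ?exprn_gt0// mulrC => /lt_trans; apply.
by rewrite ltr_pM2l// -natrX ltr_nat ltn_expl.
Qed.

Lemma sum_half_exprn n : \sum_(i < n) (2^-1 : K) ^+ i.+1 = 1 - 2^-1 ^+ n.
Proof.
elim: n => [|n IH]; first by rewrite big_ord0 expr0 subrr.
rewrite big_ord_recr/= IH; set x := _ ^+ n; rewrite exprS -/x.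
by field.
Qed.

End scalar_sequences.

(* A map T into M close to the identity on M is invertible there, and its
   inverse composed with T is a projection onto M. *)
Lemma complemented_near_identity (R : realType) (k : scalar_kind)
    (V : completeNormedModType (scalar_field R k)) (T : {linear V -> V})
    (M : set V) (b : scalar_field R k) :
    is_subspace M -> closed M -> 0 <= b -> (forall x, `|T x| <= b * `|x|) ->
    (forall x, M (T x)) -> (forall x, M x -> `|T x - x| <= 2^-1 * `|x|) ->
  complemented M.
Proof.
move=> sM cM b0 Tb TM TI.
have half0 : 0 < 2^-1 :> scalar_field R k by rewrite invr_gt0.
have Tlow x : M x -> 2^-1 * `|x| <= `|T x|.
  move=> Mx; have := ler_normB (T x) (T x - x); rewrite opprB addrC subrK => le.
  have := le_trans le (lerD (lexx _) (TI _ Mx)).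
  by rewrite {1}[ `|x| ]splitr ![_ / 2]mulrC lerD2r.
have surj y : M y -> exists z, M z /\ T z = y.
  move=> My; suff [z Mz Tz] : (T @` M) y by exists z.
  have := closed_image_bounded_below sM cM b0 half0 Tb Tlow.
  apply; apply/closure_normP => e e0.
  have [n yn] := half_exprn_small (normr_ge0 y) e0.
  (* Neumann iteration: [r] is the residual after [n] steps, and r - T r is at most half as large.
     Hence [y] is in the closure of T(M), which is closed because [T] is bounded below on [M]. *)
  have [r [r_le Mr [z Mz Tz]]] : exists r, [/\ `|r| <= `|y| * 2^-1 ^+ n, M r &
      exists2 z, M z & y - r = T z].
    elim: n {yn} => [|n [r [r_le Mr [z Mz Tz]]]].
      exists y; rewrite expr0 mulr1; split=> //; exists 0.
        by have [] := (is_subspaceP M).1 sM.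
      by rewrite subrr linear0.
    exists (r - T r); split.
    - rewrite distrC (le_trans (TI _ Mr))// exprS mulrCA.
      by rewrite ler_pM2l.
    - exact: subspaceB.
    - exists (z + r); first exact: subspaceD.
      by rewrite (linearD T) -Tz opprB addrA addrAC.
  exists (T z); first by exists z.
  by rewrite -Tz opprB addrC subrK (le_lt_trans r_le).
have injT x y : M x -> M y -> T x = T y -> x = y.
  move=> Mx My Txy; apply/eqP; rewrite -subr_eq0 -normr_le0.
  rewrite -(pmulr_rle0 _ half0) (le_trans (Tlow _ (subspaceB sM Mx My)))//.
  by rewrite linearB Txy subrr normr0.
(* [P x] is the unique point of [M] with the same image under [T] as [x], whence linearity and
   [P x = x] on [M]. *)
have [P PP] := choice (fun x => surj _ (TM x)).
have Plin : linear P.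
  move=> a x y; have [MPx TPx] := PP x; have [MPy TPy] := PP y.
  have [MP TP] := PP (a *: x + y).
  apply: injT => //; first by apply: subspaceD => //; exact: subspaceZ.
  by rewrite TP !linearP TPx TPy.
pose PL := GRing.isLinear.Build _ _ _ _ P Plin.
pose PP' : {linear V -> V} := HB.pack P PL.
have PM x : M x -> P x = x.
  by move=> Mx; have [MPx TPx] := PP x; exact: injT.
exists PP'; split=> [|x|]; rewrite /=.
- exists (2 * b) => x; have [MPx TPx] := PP x.
  rewrite -(ler_pM2l half0) -mulrA mulKf// ?pnatr_eq0//.
  by rewrite (le_trans (Tlow _ MPx))// TPx.
- by rewrite PM//; have [] := PP x.
- apply/seteqP; split=> [_ [x _ <-]|x Mx]; first by have [] := PP x.
  by exists x => //; exact: PM.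
Qed.

(** * Complemented copies of c_0 *)

Lemma limn_norm_le (K : numFieldType) (V : normedModType K) (u : nat -> V)
    (l x : V) (b : K) : 0 <= b -> u n @[n --> \oo] --> l ->
  (\forall n \near \oo, `|u n - x| <= b) -> `|l - x| <= b.
Proof.
move=> b0 ul ub; have clb : closed [set y : V | `|y - x| <= b].
  move=> y /closure_normP yb; apply: norm_lt_le => // e e0.
  have [z /= zb yz] := yb e e0; rewrite -[y](subrK z) -addrA.
  by rewrite (le_trans (ler_normD _ _))// [leLHS]addrC lerD// ltW.
exact: (closed_cvg _ clb ub _ ul).
Qed.

Lemma sum_finite_support (K : numFieldType) (V : lmodType K) (f : nat -> V)
    (a : nat -> K) n m : (forall i, (n <= i)%N -> a i = 0) -> (n <= m)%N ->
  \sum_(i < m) a i *: f i = \sum_(i < n) a i *: f i.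
Proof.
move=> a0 nm; rewrite -(big_mkord xpredT (fun i => a i *: f i)).
rewrite (big_cat_nat (leq0n n) nm)/= [X in _ + X]big_nat_cond [X in _ + X]big1
  ?addr0.
  by rewrite big_mkord.
by move=> i /andP[/andP[ni _] _]; rewrite a0// scale0r.
Qed.

Section seq_span.
Context {K : numFieldType} {V : lmodType K} (f : nat -> V).

Definition seq_span : set V := [set x | exists n (a : nat -> K),
  (forall j, (n <= j)%N -> a j = 0) /\ x = \sum_(j < n) a j *: f j].

Lemma sum_seq_span (a : nat -> K) n : seq_span (\sum_(j < n) a j *: f j).
Proof.
exists n, (fun j => if (j < n)%N then a j else 0); split.
  by move=> j nj; rewrite ltnNge nj.
by apply: eq_bigr => j _; rewrite ltn_ord.
Qed.

Lemma seq_span_subspace : is_subspace seq_span.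
Proof.
apply/is_subspaceP; split; first by exists 0, (fun=> 0); rewrite big_ord0.
move=> c _ _ [n [a [a0 ->]]] [m [b [b0 ->]]].
rewrite -(sum_finite_support f a0 (leq_maxl n m)).
rewrite -(sum_finite_support f b0 (leq_maxr n m)).
rewrite scaler_sumr -big_split/=.
under eq_bigr do rewrite scalerA -scalerDl.
exact: (sum_seq_span (fun i => c * a i + b i)).
Qed.

Lemma mem_seq_span i : seq_span (f i).
Proof.
have := sum_seq_span (fun j => (j == i)%:R) i.+1.
rewrite big_ord_recr/= eqxx scale1r big1 ?add0r// => j _.
by rewrite ltn_eqF// scale0r.
Qed.

Lemma seq_span_sub (M : set V) :
  is_subspace M -> (forall i, M (f i)) -> seq_span `<=` M.
Proof.
move=> sM Mf _ [n [a [_ ->]]].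
by apply: subspace_sum => // i _; exact: subspaceZ.
Qed.

End seq_span.

(** The c_0 norm of a finitely supported sequence. That it is attained serves to test a combination
    with the functional at its largest coefficient. *)
Lemma exists_max_norm (K : numFieldType) (a : nat -> K) n :
    (forall i, (n <= i)%N -> a i = 0) ->
  exists A : K, [/\ 0 <= A, forall i, `|a i| <= A & A = 0 \/ exists j, A = `|a
    j|].
Proof.
elim: n a => [|n IH] a a0.
  by exists 0; split=> [//|i|]; [rewrite a0// normr0|left].
have [|A [A0 aA AE]] := IH (fun i => if i == n then 0 else a i).
  by move=> i ni; case: eqVneq => // ni'; rewrite a0// ltn_neqAle eq_sym ni'.
have [le|lt] := real_leP (normr_real (a n)) (ger0_real A0).
  exists A; split=> // [i|].
    by have := aA i; case: eqVneq => [->//|].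
  case: AE => [|[j]]; first by left.
  by case: eqVneq => [_|_ AE]; [rewrite normr0; left|right; exists j].
exists `|a n|; split=> // [i|]; last by right; exists n.
have := aA i; case: eqVneq => [->//|_] /le_trans; apply; exact: ltW.
Qed.

(* An almost biorthogonal system (f, phi), with f dominated by the c_0 norm and
   phi weakly null: x |-> sum_i phi_i(x) f_i is nearly a projection onto the
   closed span of f, which is a copy of c_0. *)
Section c0_complemented.
Context {R : realType} {k : scalar_kind}.
Local Notation K := (scalar_field R k).
Context {V : completeNormedModType K}.
Variables (f : nat -> V) (phi : nat -> {scalar V}) (C B eta : K).
Hypothesis C_ge0 : 0 <= C.
Hypothesis B_ge0 : 0 <= B.
Hypothesis eta_ge0 : 0 <= eta.
Hypothesis eta_half : eta <= 2^-1.
Hypothesis eta_small : C * (eta * (2 * B)) <= 2^-1.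
Hypothesis fC : forall (a : nat -> K) (A : K) n, 0 <= A ->
  (forall i, `|a i| <= A) ->
  `|\sum_(i < n) a i *: f i| <= C * A.
Hypothesis phiB : forall i x, `|phi i x| <= B * `|x|.
Hypothesis phi0 : forall x, phi i x @[i --> \oo] --> (0 : K).
Hypothesis phif : forall i j,
  `|phi i (f j) - (i == j)%:R| <= eta * 2^-1 ^+ j.+1.

(** The errors eta 2^-(j+1) of biorthogonality sum to at most eta. *)
Let phi_sum (a : nat -> K) (A : K) n i : 0 <= A -> (forall j, (n <= j)%N ->
  a j = 0) ->
  (forall j, `|a j| <= A) -> `|phi i (\sum_(j < n) a j *: f j) - a i| <= eta * A.
Proof.
move=> A0 a0 aA; rewrite linear_sum/=.
have -> : a i = \sum_(j < n) a j * (i == j)%:R.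
  have [ni|ni] := leqP n i.
    rewrite a0// big1// => j _; rewrite gtn_eqF ?mulr0//.
    exact: leq_trans ni.
  rewrite (bigD1 (Ordinal ni))//= eqxx mulr1 big1 ?addr0// => j ij.
  by rewrite -val_eqE/= in ij; rewrite eq_sym (negbTE ij) mulr0.
rewrite -sumrB (le_trans (ler_norm_sum _ _ _))//.
rewrite (@le_trans _ _ (\sum_(j < n) eta * A * 2^-1 ^+ j.+1))//.
  apply: ler_sum => j _; rewrite linearZ/= -mulrBr normrM [eta * A]mulrC -mulrA.
  exact: ler_pM.
by rewrite -mulr_sumr sum_half_exprn ler_piMr ?mulr_ge0// gerBl exprn_ge0//
  invr_ge0.
Qed.

(** For the combination x and its largest coefficient A, [phi_sum] gives A <= B |x| + eta A, and eta
    A is absorbed since eta <= 1/2. This is the lower c_0 estimate. *)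
Let coef_bound (a : nat -> K) n : (forall j, (n <= j)%N -> a j = 0) -> forall i,
  `|a i| <= 2 * B * `|\sum_(j < n) a j *: f j|.
Proof.
move=> a0 i; have [A [A0 aA AE]] := exists_max_norm a0.
apply: (le_trans (aA i)); case: AE => [->|[j AE]]; first by rewrite !mulr_ge0.
have := phi_sum j A0 a0 aA; set x := \sum_(_ < n) _ => le.
have : A <= B * `|x| + 2^-1 * A.
  rewrite {1}AE -[a j](subKr (phi j x)) (le_trans (ler_normB _ _))// lerD//.
  by rewrite (le_trans le)// ler_wpM2r.
rewrite {1}[A]splitr [A / 2]mulrC lerD2r -mulrA => le2.
by rewrite -[A](mulVKf (_ : 2 != 0)) ?pnatr_eq0// ler_pM2l.
Qed.

Local Notation fspan := (seq_span f).

Let psum x := series (fun i => phi i x *: f i).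

(** A late block of the series has uniformly small coefficients by weak nullity, and [fC] bounds the
    block by [C] times their supremum. *)
Let psum_cvg x : cvgn (psum x).
Proof.
apply: cauchy_cvg; apply/cauchy_seriesP => e e0.
have C1 : 0 < C + 1 by rewrite ltr_wpDl.
have d0 : 0 < e / (C + 1) by rewrite divr_gt0.
have /cvgrPdist_lt/(_ _ d0) [N _ phiN] := phi0 x.
exists ([set n | (N <= n)%N], [set n | (N <= n)%N]).
  by split; exists N.
move=> [m n] [/= Nm Nn]; rewrite big_geq_mkord big_mkcond/=.
pose a i := if (m <= i)%N then phi i x else 0.
rewrite (eq_bigr (fun i : 'I_n => a i *: f i)) => [|i _]; last first.
  by rewrite /a; case: ifP; rewrite ?scale0r.
rewrite (@le_lt_trans _ _ (C * (e / (C + 1))))//.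
  apply: fC; first exact: ltW.
  move=> i; rewrite /a; case: ifP => mi; last by rewrite normr0 ltW.
  by have := phiN i (leq_trans Nm mi); rewrite /= add0r normrN => /ltW.
by rewrite mulrCA gtr_pMr// ltr_pdivrMr// mul1r ltrDl.
Qed.

Let T x : V := limn (psum x).

Let psumT x : psum x n @[n --> \oo] --> T x.
Proof. exact: psum_cvg. Qed.

Let psumE x n : psum x n = \sum_(i < n) phi i x *: f i.
Proof. by rewrite /psum /series /= big_mkord. Qed.

Let T_linear : linear T.
Proof.
move=> a x y; apply: cvg_lim => //.
rewrite (_ : psum _ = (fun n => a *: psum x n + psum y n)).
  by apply: cvgD; [apply: cvgZl_tmp|]; exact: psumT.
apply/funext => n; rewrite !psumE scaler_sumr -big_split/=.
by apply: eq_bigr => i _; rewrite linearP scalerDl scalerA.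
Qed.

Let T_bound x : `|T x| <= C * B * `|x|.
Proof.
have b0 : 0 <= C * B * `|x| by rewrite !mulr_ge0.
rewrite -[T x]subr0; apply: (limn_norm_le _ (@psumT x)) => //.
apply: nearW => n; rewrite subr0 psumE -mulrA.
by apply: (@fC (fun i => phi i x) (B * `|x|)) => //; rewrite mulr_ge0.
Qed.

(** For a finite combination y, T y - y has coefficients phi_i(y) - a_i, of size at most eta 2B |y|,
    hence norm at most C eta 2B |y|, and [eta_small] applies. The closure follows as [T] is
    bounded. *)
Let T_near_id x : closure fspan x -> `|T x - x| <= 2^-1 * `|x|.
Proof.
pose TL := GRing.isLinear.Build _ _ _ _ T T_linear.
pose T' : {linear V -> V} := HB.pack T TL.
have Tspan y : fspan y -> `|T y - y| <= 2^-1 * `|y|.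
  move=> [n [a [a0 yE]]].
  have b0 : 0 <= 2^-1 * `|y| by rewrite mulr_ge0// invr_ge0.
  apply: (limn_norm_le _ (@psumT y)) => //.
  exists n => // m /= nm;
    rewrite psumE {2}yE -(sum_finite_support f a0 nm) -sumrB.
  under eq_bigr do rewrite -scalerBl.
  have A0 : 0 <= 2 * B * `|y| by rewrite !mulr_ge0.
  have aA i : `|a i| <= 2 * B * `|y| by rewrite yE; exact: coef_bound.
  rewrite (le_trans (@fC (fun i => phi i y - a i) (eta * (2 * B * `|y|)) _ _
    _))//.
  - by rewrite mulr_ge0.
  - by move=> i; rewrite {1}yE; exact: phi_sum.
  - by rewrite !mulrA ler_wpM2r// -!mulrA.
move=> /closure_normP xN; apply: norm_lt_le => [|e e0].
  by rewrite mulr_ge0// invr_ge0.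
(* Replacing [x] by a nearby y in the span costs (C B + 3/2) |x - y| in total. *)
have D0 : 0 < C * B + 2 by rewrite ltr_wpDl// mulr_ge0.
have [y /Tspan Ty xy] := xN (e / (C * B + 2)) (divr_gt0 e0 D0).
have -> : T x - x = T (x - y) + (T y - y) - (x - y).
  by rewrite [T (x - y)](linearB T') addrA subrK opprB addrA subrK.
rewrite (le_trans (ler_normB _ _))// (le_trans (lerD (ler_normD _ _) (lexx _)))//.
rewrite (@le_trans _ _ (C * B * `|x - y| + 2^-1 * (`|x| + `|x - y|) + `|x -
  y|))//.
  rewrite lerD// lerD// (le_trans Ty)// ler_wpM2l ?invr_ge0//.
  by rewrite -{1}[y](subKr x) ler_normB.
rewrite (@le_trans _ _ (2^-1 * `|x| + (C * B + 2) * `|x - y|))//; last first.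
  by rewrite lerD2l mulrC -ler_pdivlMr// ltW.
have : 0 <= `|x - y| by []; move: `|x - y| `|x| (C * B) => u v w u0.
rewrite -subr_ge0 (_ : _ - _ = 2^-1 * u) ?mulr_ge0 ?invr_ge0//.
by field.
Qed.

Lemma c0_complemented (M : set V) : is_subspace M -> closed M ->
    (forall i, M (f i)) ->
  exists N, [/\ is_subspace N, N `<=` M, infinite_dimensional N & complemented N].
Proof.
move=> sM cM Mf; exists (closure fspan); split.
- exact: closure_subspace (seq_span_subspace f).
- exact: closure_sub_closed (seq_span_sub _ _).
- apply: independent_infinite_dimensional => n; exists f; split.
    by move=> i; apply: subset_closure; exact: mem_seq_span.
  move=> a a0 i ni; apply/eqP; rewrite -normr_le0.
  pose b j := if (j < n)%N then a j else 0.
  have b0 j : (n <= j)%N -> b j = 0 by move=> nj; rewrite /b ltnNge nj.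
  have := coef_bound b0 i; rewrite {1}/b ni => /le_trans; apply.
  rewrite (eq_bigr (fun j : 'I_n => a j *: f j)) ?a0 ?normr0 ?mulr0//.
  by move=> j _; rewrite /b ltn_ord.
- pose TL := GRing.isLinear.Build _ _ _ _ T T_linear.
  pose T' : {linear V -> V} := HB.pack T TL.
  apply: (@complemented_near_identity _ _ _ T' _ (C * B)).
  + exact: closure_subspace (seq_span_subspace f).
  + exact: closed_closure.
  + by rewrite mulr_ge0.
  + exact: T_bound.
  + move=> x; apply: (closed_cvg _ (@closed_closure _ fspan) _ _ (@psumT x)).
    by apply: nearW => n; apply: subset_closure; rewrite psumE;
      exact: (sum_seq_span f (fun i => phi i x)).
  + exact: T_near_id.
Qed.

End c0_complemented.

(** * Sequences in scattered compact spaces *)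

(** Dependent choice for constructions in which each term is subject to conditions against all
    earlier ones. *)
Lemma history_choice (A : Type) (Q : seq A -> A -> Prop) :
  (forall s, exists a, Q s a) -> exists u : nat ->
    A, forall n, Q (mkseq u n) (u n).
Proof.
move=> /choice[g Qg];
  pose L := fix L n := if n is m.+1 then rcons (L m) (g (L m)) else [::].
exists (fun n => g (L n)) => n.
suff -> : mkseq (fun n => g (L n)) n = L n by exact: Qg.
by elim: n => //= n IH; rewrite mkseqS IH.
Qed.

(** The cluster set of [u] is closed and nonempty, so it has an isolated point s. A subsequence
    inside a neighbourhood of s whose closure contains no other cluster point can cluster only at s,
    and converges to s by compactness. *)
Lemma compact_scattered_subsequence (T : topologicalType) (u : nat -> T) :
    compact [set: T] -> hausdorff_space T -> scattered T ->
  exists (sigma : nat -> nat) (s : T),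
    {homo sigma : m n / (m < n)%N} /\ u (sigma n) @[n --> \oo] --> s.
Proof.
move=> cT hT sT; pose A := cluster (u @ \oo).
have clA : closed A.
  by rewrite /A clusterE; apply: closed_bigI => B _; exact: closed_closure.
have A0 : A !=set0.
  by have [s [_ As]] := cT (u @ \oo) _ filterT; exists s.
have [s [/set_mem As [W sW WA]]] := sT _ clA A0.
have [B sB BW] := compact_regular hT cT filterT sW.
have ex N : exists n, (N <= n)%N /\ B (u n).
  have NF : (u @ \oo) [set u n | n in [set n | (N <= n)%N]].
    by exists N => // n /= Nn; exists n.
  by have [_ [[n /= Nn <-] Bn]] := As _ _ NF sB; exists n.
have [g gP] := choice ex.
pose sigma := fix sigma n := if n is m.+1 then g (sigma m).+1 else g 0.
have sigmaS n : (sigma n < sigma n.+1)%N by have [] := gP (sigma n).+1.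
have sigma_homo : {homo sigma : m n / (m < n)%N}.
  exact: homo_ltn ltn_trans sigmaS.
have sigma_ge n : (n <= sigma n)%N.
  by elim: n => // n IH; exact: leq_ltn_trans (sigmaS n).
exists sigma, s; split=> //.
have Bsigma n : B (u (sigma n)) by case: n => [|n];
  [have [] := gP 0|have [] := gP (sigma n).+1].
have sub : cluster ((fun n => u (sigma n)) @ \oo) `<=` [set s].
  rewrite -WA => y cy; split.
    apply: BW => C Cy; apply: cy => //; exists 0 => // n _; exact: Bsigma.
  move=> C D [N _ NC] yD; apply: cy => //; exists N => // n /= Nn.
  by apply: NC => /=; exact: leq_trans (sigma_ge n).
apply: (compact_cluster_set1 hT cT); [exact: filterT|exact: filterT|].
apply/seteqP; split=> // _ ->.
have [z [_ cz]] := cT ((fun n => u (sigma n)) @ \oo) _ filterT.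
by rewrite -(sub _ cz).
Qed.

(** * Subspaces of C(K, X) *)

Section cfun_subspaces.
Context {R : realType} {k : scalar_kind} {T : topologicalType}.
Context (cT : compact [set: T]) (X : completeNormedModType (scalar_field R k)).
Local Notation K := (scalar_field R k).
Local Notation C := (cfun cT X).
Implicit Types (F G : set T) (M N : set C) (f g : C) (t : T).

Definition cfun_eval t f : X := f t.

Lemma cfun_eval_linear t : linear (cfun_eval t).
Proof. by []. Qed.

HB.instance Definition _ t :=
  GRing.isLinear.Build K C X _ (cfun_eval t) (cfun_eval_linear t).

Lemma cfun_eval_le t f : `|cfun_eval t f| <= `|f|.
Proof. exact: cfun_norm_ub. Qed.

Lemma cfun_eval_sum t n (g : 'I_n ->
  C) : (\sum_(i < n) g i) t = \sum_(i < n) g i t.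
Proof. exact: (linear_sum (cfun_eval t)). Qed.

(** The strict inequality at some point of [F] avoids forming a supremum over [F]; strictness is why
    0 is excluded. *)
Definition norming F M := exists2 c : K, 0 < c &
  forall f, M f -> f != 0 -> exists2 t, F t & c * `|f| < `|f t|.

Definition strictly_singular F M := forall N, is_subspace N -> N `<=` M ->
  infinite_dimensional N -> forall e : K, 0 < e ->
  exists f, [/\ N f, `|f| = 1 & forall t, F t -> `|f t| <= e].

Definition has_complemented M := exists N, [/\ is_subspace N, N `<=` M,
  infinite_dimensional N & complemented N].

Definition subprojective_on F := forall M, is_subspace M -> closed M ->
  infinite_dimensional M -> norming F M -> has_complemented M.

Lemma has_complementedS N M : N `<=` M -> has_complemented N ->
  has_complemented M.
Proof.
by move=> NM [N' [sN' N'N iN' cN']]; exists N'; split=> // f /N'N/NM.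
Qed.

Lemma subprojective_onS F G : F `<=` G -> subprojective_on G ->
  subprojective_on F.
Proof.
move=> FG gG M sM cM iM [c c0 Mc]; apply: gG => //; exists c => // f Mf f0.
by have [t Ft ft] := Mc _ Mf f0; exists t => //; exact: FG.
Qed.

(** If strict singularity fails, [F] norms some infinite-dimensional subspace N of [M] with a
    constant e, hence also the closure of N, with constant e/2. *)
Lemma subprojective_on_or_strictly_singular F M : subprojective_on F ->
  is_subspace M -> closed M ->
  has_complemented M \/ strictly_singular F M.
Proof.
move=> gF sM cM; have [|nss] := pselect (strictly_singular F M); first by right.
left; move: nss => /existsNP[N] /not_implyP[sN] /not_implyP[NM] /not_implyP[iN].
move=> /existsNP[e] /not_implyP[e0] nsmall.
have Ne f : N f -> f != 0 -> exists2 t, F t & e * `|f| < `|f t|.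
  move=> Nf f0; have nf0 : 0 < `|f| by rewrite normr_gt0.
  apply: contrapT => small; apply: nsmall; exists (`|f|^-1 *: f); split.
  - exact: subspaceZ.
  - by rewrite normrZ normfV normr_id mulVf// normr_eq0.
  - move=> t Ft; rewrite cfunZE normrZ normfV normr_id ler_pdivrMl// mulrC.
    rewrite real_leNgt ?realM ?normr_real// ?gtr0_real//.
    by apply/negP => ft; apply: small; exists t.
apply: (has_complementedS (closure_sub_closed cM NM)).
apply: gF; [exact: closure_subspace|exact: closed_closure| |].
  exact: (infinite_dimensionalS sN (@subset_closure _ N)).
exists (e / 2); first by rewrite divr_gt0.
move=> f /closure_normP Nf f0; have nf0 : 0 < `|f| by rewrite normr_gt0.
have e1 : 0 < e + 1 by rewrite addr_gt0.
(* Chosen so that (e + 1) |f - g| <= (e/2) |f|, which is what e (|f| - |f - g|) - |f - g| >= (e/2)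
   |f| requires. *)
pose d := e / 2 / (e + 1); have d0 : 0 < d by rewrite !divr_gt0.
have [g Ng fg] := Nf (d * `|f|) (mulr_gt0 d0 nf0).
have gf : `|f| - `|f - g| <= `|g|.
  by rewrite lerBlDr addrC -{1}[f](subrK g) ler_normD.
have d1 : d < 1.
  by rewrite ltr_pdivrMr// mul1r ltr_wpDr// ltr_pdivrMr// ltr_pMr// ltr1n.
have g0 : g != 0.
  rewrite -normr_gt0; apply: lt_le_trans gf; rewrite subr_gt0 (lt_trans fg)//.
  by rewrite gtr_pMl.
have [t Ft gt] := Ne g Ng g0; exists t => //.
have ft : `|g t| - `|f - g| <= `|f t|.
  rewrite lerBlDr (@le_trans _ _ (`|f t| + `|(f - g) t|))//; last first.
    by rewrite lerD2l cfun_norm_ub.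
  by rewrite cfunDE cfunNE -{1}[g t](subKr (f t)) ler_normB.
apply: lt_le_trans ft; rewrite ltrBrDr; apply: le_lt_trans gt.
rewrite (@le_trans _ _ (e * (`|f| - `|f - g|)))//; last by rewrite ler_pM2l.
have : (e + 1) * `|f - g| <= e / 2 * `|f|.
  by rewrite -ler_pdivlMl// mulrA [_^-1 * _]mulrC ltW.
rewrite -subr_ge0 => fg0; rewrite -subr_ge0.
move: fg0; congr (0 <= _); move: `|f| `|f - g| => u v.
by field.
Qed.

(* The u_n below satisfy nf(u_i)(u_n) = 0 for i < n, where nf(u_i) is a norm-one
   functional with value 1 at u_i; hence |a_i| <= 2^i |sum_j a_j u_j|, and it
   suffices that u_n be of size e 2^-(2n+1) on F. *)
Lemma strictly_singular_small_subspace F M (e : K) : strictly_singular F M ->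
    is_subspace M -> infinite_dimensional M -> 0 < e ->
  exists N, [/\ is_subspace N, N `<=` M, infinite_dimensional N &
    forall f t, N f -> F t -> `|f t| <= e * `|f|].
Proof.
move=> ssF sM iM e0.
have [nf nfP] : exists nf : C -> {scalar C}, forall g, g != 0 ->
    nf g g = 1 /\ forall f, `|nf g f| <= `|f| / `|g|.
  have ex g : exists phi : {scalar C}, g != 0 ->
      phi g = 1 /\ forall f, `|phi f| <= `|f| / `|g|.
    have [->|g0] := eqVneq g 0; first by exists \0 => /eqP.
    by have [phi phiP] := hahn_banach g0; exists phi.
  by have [nf nfP] := choice ex; exists nf.
have half0 : 0 < 2^-1 :> K by rewrite invr_gt0.
pose d n : K := e * 2^-1 ^+ n.+1 * 2^-1 ^+ n.
have d0 n : 0 < d n by rewrite !mulr_gt0// exprn_gt0.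
have [u uP] : exists u : nat -> C, forall n, [/\ M (u n), `|u n| = 1,
    forall i, (i < n)%N -> nf (u i) (u n) = 0 &
    forall t, F t -> `|u n t| <= d n].
  pose Q (s : seq C) f := [/\ M f, `|f| = 1,
    forall i, (i < size s)%N -> nf (nth 0 s i) f = 0 &
    forall t, F t -> `|f t| <= d (size s)].
  have [|u uP] := @history_choice C Q.
    move=> s; pose phi i := nf (nth 0 s i).
    have [f [[Mf phif] f1 fF]] := ssF _ (@subspace_kernels _ _ M phi (size s) sM)
      (fun _ h => h.1) (@infinite_dimensional_kernels _ _ M phi (size s) sM iM)
      _ (d0 (size s)).
    by exists f.
  exists u => n; have [Mu u1 un uF] := uP n; rewrite size_mkseq in un uF.
  by split=> // i ni; have := un i ni; rewrite nth_mkseq.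
have u_neq0 n : u n != 0.
  by have [_ u1 _ _] := uP n; rewrite -normr_gt0 u1.
have coef (a : nat -> K) n i : (i < n)%N ->
    `|a i| <= 2 ^+ i * `|\sum_(j < n) a j *: u j|.
  set h := \sum_(_ < n) _.
  elim/ltn_ind: i => i IH ni.
  have [nfi nfle] := nfP _ (u_neq0 i).
  (* [nf (u i)] kills the terms after i. By induction the earlier ones contribute at most (1 + 2 +
     ... + 2^(i-1)) |h|, which together with |h| makes 2^i |h|. *)
  have aE : a i = nf (u i) h - \sum_(j < i) a j * nf (u i) (u j).
    rewrite /h linear_sum/= -(big_mkord xpredT (fun j => nf (u i) (a j *: u j))).
    rewrite (big_cat_nat (leq0n i) (ltnW ni))/= big_mkord.
    rewrite (eq_bigr (fun j : 'I_i => a j * nf (u i) (u j))) => [|j _];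
      last first.
      by rewrite linearZ.
    rewrite addrC addrK big_ltn// linearZ/= nfi mulr1 big_nat_cond big1 ?addr0//.
    move=> j /andP[/andP[ij _] _]; rewrite linearZ/=.
    by have [_ _ -> //] := uP j; rewrite mulr0.
  have nf1 f : `|nf (u i) f| <= `|f|.
    by have [_ u1 _ _] := uP i; have := nfle f; rewrite u1 divr1.
  have sum2 m : \sum_(j < m) (2 : K) ^+ j = 2 ^+ m - 1.
    elim: m => [|m IHm]; first by rewrite big_ord0 expr0 subrr.
    by rewrite big_ord_recr/= IHm exprS; ring.
  rewrite aE (le_trans (ler_normB _ _))//.
  rewrite (@le_trans _ _ (`|h| + \sum_(j < i) 2 ^+ j * `|h|))//.
    rewrite lerD// (le_trans (ler_norm_sum _ _ _))// ler_sum// => j _.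
    rewrite normrM -[leRHS]mulr1 ler_pM//; first exact: IH (ltn_trans _ ni).
    by have [_ <- _ _] := uP j; exact: nf1.
  by rewrite -mulr_suml sum2 mulrBl mul1r addrC subrK.
exists (seq_span u); split.
- exact: seq_span_subspace.
- by apply: seq_span_sub => // i; have [] := uP i.
- apply: independent_infinite_dimensional => n; exists u; split.
    by move=> i; exact: mem_seq_span.
  move=> a a0 i ni; apply/eqP; rewrite -normr_le0 (le_trans (coef a n i ni))//.
  by rewrite a0 normr0 mulr0.
- move=> _ t [n [a [_ ->]]] Ft; set h := \sum_(_ < n) _.
  rewrite cfun_eval_sum (le_trans (ler_norm_sum _ _ _))//.
  rewrite (@le_trans _ _ (\sum_(j < n) e * `|h| * 2^-1 ^+ j.+1))//; last first.
    rewrite -mulr_sumr sum_half_exprn ler_piMr ?mulr_ge0// ?(ltW e0)//.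
  apply: ler_sum => j _; rewrite cfunZE normrZ.
  have -> : e * `|h| * 2^-1 ^+ j.+1 = 2 ^+ j * `|h| * d j.
    have E : 2 ^+ j * 2^-1 ^+ j = 1 :> K
      by rewrite -exprMn divff ?expr1n// pnatr_eq0.
    rewrite -[LHS](mulr1 (_ * _)) -[X in _ * X = _]E /d.
    by move: (2 ^+ j) (2^-1 ^+ j) (2^-1 ^+ j.+1) => p q r; ring.
  apply: ler_pM => //; first exact: coef.
  by have [_ _ _] := uP j; apply.
Qed.

Lemma subprojective_on0 : subprojective_on set0.
Proof.
move=> M sM _ iM [c _ Mc]; have [f Mf f0] := infinite_dimensional_neq0 sM iM.
by have [t []] := Mc f Mf f0.
Qed.

(** Otherwise both restrictions are strictly singular. In a subspace whose elements are at most c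
    times their norm on [F] there is a unit vector at most c on [G], against the norming constant
    c. *)
Lemma subprojective_onU F G : subprojective_on F -> subprojective_on G ->
  subprojective_on (F `|` G).
Proof.
move=> gF gG M sM cM iM [c c0 Mc].
have [//|ssF] := subprojective_on_or_strictly_singular gF sM cM.
have [//|ssG] := subprojective_on_or_strictly_singular gG sM cM.
have [N [sN NM iN Nc]] := strictly_singular_small_subspace ssF sM iM c0.
have [f [Nf f1 fG]] := ssG N sN NM iN c c0.
have [|t [Ft|Gt]] := Mc f (NM _ Nf); first by rewrite -normr_gt0 f1.
  by rewrite le_gtF// Nc.
by rewrite f1 mulr1 le_gtF// fG.
Qed.

(** The sets A for which [F] minus A is subprojective form a filter, proper if [F] is not
    subprojective. It would have a cluster point in [F], but it contains the complement of a
    subprojective neighbourhood of that point. *)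
Lemma subprojective_on_compact F : compact F ->
  (forall t, F t -> exists2 U, nbhs t U & subprojective_on U) ->
    subprojective_on F.
Proof.
move=> cF locF; apply: contrapT => ngF.
pose S := [set A : set T | subprojective_on (F `\` A)].
have SF : ProperFilter S.
  split; first by rewrite /S/= setD0.
  split; rewrite /S/=.
  - by rewrite setDT; exact: subprojective_on0.
  - by move=> A B gA gB; rewrite /= setDIr; exact: subprojective_onU.
  - by move=> A B AB; apply: subprojective_onS; exact: setDS.
have [|t [Ft tS]] := cF S SF; first by rewrite /S/= setDv;
  exact: subprojective_on0.
have [U tU gU] := locF t Ft.
have [|s [/= nUs Us]] := tS (~` U) U _ tU; last exact: nUs.
by rewrite /S/= setDE setCK; apply: subprojective_onS gU; exact: subIsetr.
Qed.

(** Evaluation is an isomorphism of [M] onto a closed subspace of [X]; a projection there is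
    conjugated back, [q f] being the element of [M] with value P (f t) at [t]. *)
Lemma subprojective_on_point t : subprojective X -> subprojective_on [set t].
Proof.
move=> hX M sM cM iM [c c0 Mc].
have Mlow f : M f -> c * `|f| <= `|cfun_eval t f|.
  move=> Mf; have [->|f0] := eqVneq f 0; first by rewrite normr0 mulr0.
  by have [_ -> /ltW] := Mc f Mf f0.
pose Y := cfun_eval t @` M.
have sY : is_subspace Y.
  apply/is_subspaceP; split.
    by exists 0; [have [] := (is_subspaceP M).1 sM|rewrite linear0].
  move=> a _ _ [f Mf <-] [g Mg <-]; exists (a *: f + g); last by rewrite linearP.
  by have [_] := (is_subspaceP M).1 sM; apply.
have cY : closed Y.
  apply: (closed_image_bounded_below sM cM ler01 c0) => // f.
  by rewrite mul1r cfun_eval_le.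
have injM f g : M f -> M g -> cfun_eval t f = cfun_eval t g -> f = g.
  move=> Mf Mg fg; apply/eqP; rewrite -subr_eq0 -normr_le0 -(pmulr_rle0 _ c0).
  rewrite (le_trans (Mlow _ (subspaceB sM Mf Mg)))//.
  by rewrite -[cfun_eval t (f - g)]/(cfun_eval t f - cfun_eval t g) fg subrr
    normr0.
have iY : infinite_dimensional Y.
  move=> [n [y [Yy yY]]]; have ex i : exists f, M f /\ cfun_eval t f = y i.
    by have [f Mf fy] := Yy i; exists f.
  have [e eP] := choice ex.
  apply: iM; exists n, (fun i => e i); split=> [i|f Mf]; first by have [] := eP i.
  have [a fa] := yY _ (imageP (cfun_eval t) Mf); exists a.
  apply: injM => //.
    by apply: subspace_sum => // i _; apply: subspaceZ => //; have [] := eP i.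
  rewrite fa linear_sum; apply: eq_bigr => i _.
  by rewrite linearZ/=; have [_ ->] := eP i.
have [W [sW WY iW [P [[b Pb] PP PW]]]] := hX Y sY cY iY.
have PY x : Y (P x) by apply: WY; rewrite -PW; exists x.
have PWid x : W x -> P x = x by rewrite -PW => -[z _ <-].
have ex f : exists g, M g /\ cfun_eval t g = P (cfun_eval t f).
  by have [g Mg gf] := PY (cfun_eval t f); exists g.
have [q qP] := choice ex.
have qlin : linear q.
  move=> a f g; have [Mqf qf] := qP f; have [Mqg qg] := qP g.
  have [Mq qE] := qP (a *: f + g).
  apply: injM => //; first by apply: subspaceD => //; exact: subspaceZ.
  rewrite qE -[cfun_eval t (a *: f + g)]/(a *: cfun_eval t f + cfun_eval t g).
  by rewrite linearP -qf -qg.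
pose qL := GRing.isLinear.Build _ _ _ _ q qlin.
pose Q : {linear C -> C} := HB.pack q qL.
have qWE f : W (cfun_eval t f) -> M f -> q f = f.
  by move=> Wf Mf; have [Mqf qf] := qP f; apply: injM => //; rewrite qf PWid.
have qW f : W (cfun_eval t (q f)).
  by have [_ ->] := qP f; rewrite -PW; exists (cfun_eval t f).
exists (range q); split.
- apply/is_subspaceP; split; first by exists 0 => //; exact: (linear0 Q).
  move=> a _ _ [f _ <-] [g _ <-]; exists (a *: f + g) => //.
  exact: (linearP Q).
- by move=> _ [f _ <-]; have [] := qP f.
- move=> [n [e [eN eP]]]; apply: iW; exists n, (fun i => cfun_eval t (e i)).
  split=> [i|w Ww]; first by have [f _ <-] := eN i; exact: qW.
  have [f Mf fw] := WY _ Ww.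
  have [|a fa] := eP f.
    by exists f => //; apply: qWE => //; rewrite fw.
  exists a; rewrite -fw fa linear_sum; apply: eq_bigr => i _.
  by rewrite linearZ.
- exists Q; split=> //=.
  (* The bound [b] comes without a sign, hence the absolute value. *)
  + exists (c^-1 * `|b|) => f; have [Mqf qf] := qP f.
    rewrite -mulrA ler_pdivlMl// (le_trans (Mlow _ Mqf))// qf (le_trans (Pb _))//.
    rewrite -[leLHS](ger0_norm (le_trans (normr_ge0 _) (Pb _))) normrM normr_id.
    by rewrite ler_wpM2l// cfun_eval_le.
  + by move=> f; have [Mqf _] := qP f; exact: qWE.
Qed.

End cfun_subspaces.

(** * Gliding humps *)

Section humps.
Context {R : realType} {k : scalar_kind} {T : topologicalType}.
Context {cT : compact [set: T]} {X : completeNormedModType (scalar_field R k)}.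
Local Notation K := (scalar_field R k).
Local Notation C := (cfun cT X).
Implicit Types (F : set T) (M : set C) (f g : C) (t : T).

(* The constants are those for which [c0_complemented] applies with
   C = B = 2 / c and eta = c^2 / 16. *)
Lemma has_complemented_humps F M (c : K) (f : nat -> C) (u : nat -> T) (s : T) :
    is_subspace M -> closed M -> 0 < c ->
    (forall g, M g -> g != 0 -> exists2 t, F t & c * `|g| < `|g t|) ->
    (forall i, M (f i)) -> (forall i, `|f i| = 1) ->
    (forall i j t, i != j -> F t ->
      `|f i t| <= c ^+ 3 / 32 * 2^-1 ^+ i.+1 \/
      `|f j t| <= c ^+ 3 / 32 * 2^-1 ^+ j.+1) ->
    (forall i, F (u i)) -> (forall i, c < `|f i (u i)|) ->
    u n @[n --> \oo] --> s ->
  has_complemented M.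
Proof.
move=> sM cM c0 Mc Mf f1 fsep Fu fu us.
pose eps i : K := c ^+ 3 / 32 * 2^-1 ^+ i.+1.
have c1 : c <= 1.
  by rewrite -(f1 0) (le_trans (ltW (fu 0)))// cfun_norm_ub.
have half0 : 0 < 2^-1 :> K by rewrite invr_gt0.
have half1 : 2^-1 <= 1 :> K by rewrite invf_le1// ler1n.
have d0 : 0 < c ^+ 3 / 32 by rewrite divr_gt0// exprn_gt0.
have dc : c ^+ 3 / 32 <= c.
  rewrite ler_pdivrMr// exprS ler_pM2l// (@le_trans _ _ 1)//.
    by rewrite exprn_ile1// ltW.
  by rewrite ler1n.
have eps0 i : 0 < eps i by rewrite mulr_gt0// exprn_gt0.
have epsc i : eps i <= c.
  by rewrite (le_trans _ dc)// ler_piMr ?(ltW d0)// exprn_ile1// ltW.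
(* At its own peak f_j exceeds c >= eps_j, so the separation makes every other f_i small there. *)
have feps i j : i != j -> `|f i (u j)| <= eps i.
  move=> ij; have [//|fj] := fsep i j (u j) ij (Fu j).
  by have := le_trans fj (epsc j); rewrite lt_geF.
have cvg_us (g : C) : g (u n) @[n --> \oo] --> g s.
  exact: (@continuous_cvg _ _ _ _ _ u g s (@cfun_continuous _ _ cT X g s) us).
have fs i : `|f i s| <= eps i.
  rewrite -[f i s]subr0; apply: limn_norm_le (cvg_us (f i)) _; first exact: ltW.
  exists i.+1 => // n /= ni; rewrite subr0; apply: feps.
  by rewrite ltn_eqF.
have fu0 i : f i (u i) != 0 by rewrite -normr_gt0 (lt_trans c0).
have ex i : exists psi : {scalar X}, psi (f i (u i)) = 1 /\
    forall x, `|psi x| <= c^-1 * `|x|.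
  have [psi [psi1 psile]] := hahn_banach (fu0 i); exists psi; split=> // x.
  rewrite (le_trans (psile x))// mulrC ler_wpM2r// lef_pV2 ?posrE ?normr_gt0//.
  exact: ltW.
have [psi psiP] := choice ex.
(* Subtracting g(s) makes these functionals weakly null, and changes little on f_i, which is small
   at s. *)
pose phif i (g : C) : K := psi i (g (u i) - g s).
have phi_lin i : scalar (phif i).
  move=> a g h; rewrite /phif !cfunDE !cfunZE.
  by rewrite opprD addrACA -scalerBr linearP.
pose phiL i := GRing.isLinear.Build _ _ _ _ (phif i) (@phi_lin i).
pose phi i : {scalar C} := HB.pack (phif i) (phiL i).
have phile i g : `|phi i g| <= c^-1 * `|g (u i) - g s|.
  by have [_] := psiP i; apply.
have cV0 : 0 <= c^-1 by rewrite invr_ge0 ltW.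
(* The constants fit: two errors c^3/32 times the bound 1/c of psi_i give eta = c^2/16, and then C
   eta 2B is exactly 1/2. *)
have eta_half (K' : numFieldType) (b : K') :
    b != 0 -> 2 / b * (b ^+ 2 / 16 * (2 * (2 / b))) = 2^-1.
  by move=> b0; field.
have eta_eps (K' : numFieldType) (b p : K') : b != 0 ->
    b ^+ 2 / 16 * p = b^-1 * (b ^+ 3 / 32 * p + b ^+ 3 / 32 * p).
  by move=> b0; field.
have two0 : 0 <= 2 / c by rewrite mulr_ge0.
have eta0 : 0 <= c ^+ 2 / 16 by rewrite divr_ge0// exprn_ge0// ltW.
apply: (@c0_complemented _ _ _ f phi (2 / c) (2 / c) (c ^+ 2 / 16)) => //.
- rewrite ler_pdivrMr// (@le_trans _ _ 1)//; first by rewrite exprn_ile1// ltW.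
  by rewrite ler_pdivlMl// mulr1 ler_nat.
- by rewrite eta_half// lt0r_neq0.
- move=> a A n A0 aA; set h := \sum_(_ < n) _.
  have [->|h0] := eqVneq h 0; first by rewrite normr0 mulr_ge0.
  have Mh : M h by apply: subspace_sum => // i _; exact: subspaceZ.
  have [t Ft ht] := Mc h Mh h0.
  rewrite mulrAC ler_pdivlMr// mulrC (le_trans (ltW ht))//.
  rewrite cfun_eval_sum (le_trans (ler_norm_sum _ _ _))//.
  (* At each point of [F] at most one f_j is not small; this gives the upper c_0 estimate. *)
  have [j fj] : exists j, forall i, `|f i t| <= eps i + (i == j)%:R.
    have [[j fj]|allsmall] := pselect (exists j, ~ `|f j t| <= eps j); last first.
      exists 0 => i; apply: (@le_trans _ _ (eps i)); last by rewrite lerDl ler0n.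
      by apply: contrapT => fi; apply: allsmall; exists i.
    exists j => i; have [->|ij] := eqVneq i j.
      by rewrite -[leLHS]add0r lerD ?(ltW (eps0 j))// -(f1 j) cfun_norm_ub.
    by rewrite addr0; have [|/fj] := fsep i j t ij Ft.
  rewrite (@le_trans _ _ (\sum_(i < n) A * (eps i + (i == j :> nat)%:R)))//.
    by apply: ler_sum => i _; rewrite cfunZE normrZ ler_pM.
  rewrite -mulr_sumr mulrC ler_wpM2r// big_split/=.
  rewrite [leRHS](_ : 2 = 1 + 1)// lerD//.
    rewrite -mulr_sumr sum_half_exprn.
    rewrite (@le_trans _ _ (c ^+ 3 / 32))// ?(le_trans dc)//.
    by rewrite ler_piMr ?(ltW d0)// gerBl exprn_ge0// ltW.
  have [jn|jn] := ltnP j n.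
    rewrite (bigD1 (Ordinal jn))//= eqxx big1 ?addr0// => i ij.
    by rewrite -val_eqE/= in ij; rewrite (negbTE ij).
  rewrite big1// => i _; rewrite ltn_eqF//; exact: leq_trans jn.
- move=> i g; rewrite (le_trans (phile i g))// [2 / c]mulrC -mulrA ler_wpM2l//.
  rewrite (le_trans (ler_normB _ _))// mulrDl mul1r.
  by rewrite lerD// cfun_norm_ub.
- move=> g; apply/cvgrPdist_lt => e e0.
  have /cvgrPdist_lt/(_ (c * e) (mulr_gt0 c0 e0)) := cvg_us g.
  apply: filterS => n gn; rewrite sub0r normrN (le_lt_trans (phile n g))//.
  by rewrite ltr_pdivrMl// distrC.
- move=> i j; rewrite (eta_eps _ _ _ (lt0r_neq0 c0)) -/(eps j).
  have [<-|ij] := eqVneq i j.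
    rewrite -[_ - _]/(phi i (f i) - 1).
    have -> : phi i (f i) - 1 = - psi i (f i s).
      rewrite -[phi i (f i)]/(psi i (f i (u i) - f i s)) linearB.
      by have [-> _] := psiP i; rewrite addrAC subrr add0r.
    rewrite normrN; have [_ psii] := psiP i; rewrite (le_trans (psii _))//.
    by rewrite ler_wpM2l// (le_trans (fs i))// lerDl ltW.
  rewrite subr0 (le_trans (phile i (f j)))// ler_wpM2l//.
  by rewrite (le_trans (ler_normB _ _))// lerD// feps// eq_sym.
Qed.

End humps.

(** The peak sets of finitely many earlier vectors, all small at [t], form a closed subset of [F]
    missing [t]. Unless [M] already has a complemented subspace, restriction to this set and [t] is
    strictly singular and yields the next unit vector. No two of these vectors are both large at a
    point of [F]. *)
Lemma subprojective_on_punctured (R : realType) (k : scalar_kind) (T :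
  topologicalType)
    (cT : compact [set: T]) (X : completeNormedModType (scalar_field R k))
    (F : set T) (t : T) :
    hausdorff_space T -> scattered T -> closed F ->
      subprojective_on cT X [set t] ->
    (forall G, closed G -> G `<=` F -> ~ G t -> subprojective_on cT X G) ->
  subprojective_on cT X F.
Proof.
move=> hT sT clF gt gG M sM cM iM [c c0 Mc].
apply: contrapT => nM.
pose eps i : scalar_field R k := c ^+ 3 / 32 * 2^-1 ^+ i.+1.
have eps0 i : 0 < eps i by rewrite mulr_gt0 ?divr_gt0 ?exprn_gt0 ?invr_gt0.
have eps_le i j : (i <= j)%N -> eps j <= eps i.
  move=> ij; rewrite ler_wpM2l ?divr_ge0 ?exprn_ge0 ?(ltW c0)//.
  by rewrite ler_wiXn2l ?invr_ge0// invf_le1// ler1n.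
pose peak (g : cfun cT X) i := [set x | F x /\ ~ `|g x| < eps i].
have cl_peak g i : closed (peak g i).
  apply: closedI => //; apply: open_closedC; rewrite openE => x /= gx.
  have d0 : 0 < eps i - `|g x| by rewrite subr_gt0.
  have /cvgrPdist_lt/(_ _ d0) := @cfun_continuous _ _ cT X g x.
  apply: filterS => y /=; rewrite ltrBrDl => /le_lt_trans; apply.
  by rewrite -{1}[g y](subKr (g x)) ler_normB.
(* Every list must have a continuation, so smallness of the earlier terms at [t] is a premise here;
   [ft] discharges it by strong induction. *)
pose Q (s : seq (cfun cT X)) f :=
  (forall i, (i < size s)%N -> `|nth 0 s i t| < eps i) ->
  [/\ M f, `|f| = 1, `|f t| < eps (size s) &
    forall i x, (i < size s)%N -> peak (nth 0 s i) i x -> `|f x| <= eps (size s)].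
have [|f fQ] := @history_choice _ Q.
  move=> s; have [st|nst] := pselect (forall i, (i < size s)%N ->
    `|nth 0 s i t| < eps i);
    last by exists 0.
  pose G := \bigcup_(i in `I_(size s)) peak (nth 0 s i) i.
  have clG : closed G by apply: closed_bigcup => // i _; exact: cl_peak.
  have GF : G `<=` F by move=> x [i _ []].
  have nGt : ~ G t by move=> [i /= is_s [_]]; apply; exact: st.
  have [//|ssG] :=
    subprojective_on_or_strictly_singular (subprojective_onU gt (gG G clG GF nGt)) sM cM.
  (* Halving gives strict smallness at [t], which keeps [t] off the peak set. *)
  have e0 : 0 < eps (size s) / 2 by rewrite divr_gt0.
  have e_half : eps (size s) / 2 < eps (size s).
    by rewrite ltr_pdivrMr// ltr_pMr// ltr1n.
  have [f [Mf f1 fe]] := ssG M sM (fun _ h => h) iM _ e0.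
  exists f => _; split=> //; first by rewrite (le_lt_trans (fe t _))//; left.
  move=> i x is_s px; apply: le_trans (ltW e_half).
  by apply: fe; right; exists i.
have ft n : `|f n t| < eps n.
  elim/ltn_ind: n => n IH; have := fQ n; rewrite /Q size_mkseq; case=> //.
  by move=> i ni; rewrite nth_mkseq//; exact: IH.
have fP n : [/\ M (f n), `|f n| = 1 &
    forall i x, (i < n)%N -> peak (f i) i x -> `|f n x| <= eps n].
  have := fQ n; rewrite /Q size_mkseq; case=> [i ni|Mf f1 _ fpeak].
    by rewrite nth_mkseq.
  by split=> // i x ni px; apply: (fpeak i) => //; rewrite nth_mkseq.
have fsep i j x : i != j -> F x -> `|f i x| <= eps i \/ `|f j x| <= eps j.
  wlog ij' : i j / (i < j)%N => [wl ij Fx|_ Fx].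
    have [lt|gt'|eq] := ltngtP i j; first exact: wl i j lt ij Fx.
      have ji : j != i by rewrite eq_sym.
      by have [] := wl j i gt' ji Fx; [right|left].
    by rewrite eq eqxx in ij.
  have [fi|fi] := pselect (`|f i x| < eps i); first by left; exact: ltW.
  by right; have [_ _ fj] := fP j; exact: (fj i).
have ex i : exists x, F x /\ c < `|f i x|.
  have [Mf f1 _] := fP i; have f0 : f i != 0 by rewrite -normr_gt0 f1.
  by have [x Fx] := Mc _ Mf f0; rewrite f1 mulr1; exists x.
have [u uP] := choice ex.
have [sigma [s [sigma_homo us]]] := compact_scattered_subsequence u cT hT sT.
have sigma_ge n : (n <= sigma n)%N.
  by elim: n => // n IH; exact: leq_ltn_trans (sigma_homo n n.+1 _).
apply: nM; apply: (@has_complemented_humps _ _ _ _ _ F M c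
  (fun i => f (sigma i)) (fun i => u (sigma i)) s) => //.
- by move=> i; have [] := fP (sigma i).
- by move=> i; have [] := fP (sigma i).
- move=> i j x ij Fx; have nij : sigma i != sigma j.
    by move: ij; rewrite !neq_ltn => /orP[] /sigma_homo ->; rewrite ?orbT.
  by have [le|le] := fsep _ _ x nij Fx; [left|right];
    exact: le_trans le (eps_le _ _ (sigma_ge _)).
- by move=> i; have [] := uP (sigma i).
- by move=> i; have [] := uP (sigma i).
Qed.

Theorem theorem4 (R : realType) (k : scalar_kind)
    (T : topologicalType) (cT : compact [set: T])
    (hT : hausdorff_space T) (sT : scattered T)
    (X : completeNormedModType (scalar_field R k)) (hX : subprojective X) :
  subprojective (cfun cT X).
Proof.
pose B := [set t : T | ~ exists2 U, nbhs t U & subprojective_on cT X U].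
have clB : closed B.
  apply: open_closedC; rewrite openE => t [U tU gU].
  by apply: filterS (nbhs_interior tU) => x xU; exists U.
have B0 : B = set0.
  apply/eqP/negPn/negP => /set0P B0.
  have [t [/set_mem Bt [W tW WB]]] := sT B clB B0.
  have [V tV VW] := compact_regular hT cT filterT tW.
  apply: Bt; exists (closure V).
    by apply: filterS tV; exact: subset_closure.
  (* The closure of [V] meets [B] only at [t], so a closed subset of it missing [t] is compact and
     locally subprojective. *)
  apply: (subprojective_on_punctured hT sT (@closed_closure _ V)
    (subprojective_on_point (t := t) hX)).
  move=> G clG GV nGt; apply: subprojective_on_compact.
    exact: (subclosed_compact clG cT).
  move=> x Gx; apply: contrapT => nx; apply: nGt.
  have : (W `&` B) x by split=> //; exact: VW (GV _ Gx).
  by rewrite WB => <-.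
move=> M sM cM iM; have gT : subprojective_on cT X setT.
  apply: subprojective_on_compact => // x _; apply: contrapT => nx.
  by have : B x by []; rewrite B0.
(* The whole space norms [M] with any constant below 1; strictness in [norming] calls for such a
   margin. *)
apply: (gT M sM cM iM); exists 2^-1; first by rewrite invr_gt0.
move=> f Mf f0; apply: contrapT => small.
have : `|f| <= 2^-1 * `|f|.
  apply: cfun_norm_lub => [|t]; first by rewrite mulr_ge0// invr_ge0.
  rewrite real_leNgt ?normr_real ?realM ?normr_real//.
  by apply/negP => ft; apply: small; exists t.
by rewrite lt_geF// gtr_pMl ?normr_gt0// invf_lt1// ltr1n.
Qed.
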